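(* Let $N\in\mathbb{Z}_{\ge1}$, $\mu\in(0,1)$, $\gamma_0\in\mathbb{R}$, and let $\varepsilon^*>0$, $\delta^*>0$ be constants having the well-posedness property (W) stated in the context. Let $\gamma\in\mathbb{R}$, $u_0\in\operatorname{Lip}(\overline{\mathbb{R}^N_+})$ and $\psi\in\operatorname{Lip}(\overline{S^{N-1}_+})$ satisfy $$|\gamma-\gamma_0|<\varepsilon^*,\quad\|\nabla u_0-\gamma_0e_N\|_{L^\infty(\mathbb{R}^N_+)}<\varepsilon^*,\quad\|\nabla\bar\psi-\gamma_0e_N\|_{L^\infty(\mathbb{R}^N_+)}<\varepsilon^*.$$ Assume moreover that $$\lim_{r\to\infty}\frac{u_0(r\eta)}{r}=\psi(\eta)\quad\text{for }\eta\in S^{N-1}_+.$$ Let $u\in\hat B_{\delta^*}$ be the solution to (SD$_\gamma$) with $u|_{t=0}=u_0$, and let $u^{\gamma,\psi}\in\hat B_{\delta^*}$ be the self-similar solution to (SD$_\gamma$) with $u^{\gamma,\psi}|_{t=0}=\bar\psi$. Then, with $u^\sigma(x,t):=\sigma^{-1/4}u(\sigma^{1/4}x,\sigma t)$, $$u^\sigma\to u^{\gamma,\psi}\quad\text{as }\sigma\to\infty$$ uniformly on every compact subset of $\overline{\mathbb{R}^N_+}\times[0,\infty)$, and, for all $(\ell,m)\in\mathbb{Z}_{\ge0}^2$, $\nabla^\ell\partial_t^mu^\sigma\to\nabla^\ell\partial_t^mu^{\gamma,\psi}$ uniformly on every compact subset of $\overline{\mathbb{R}^N_+}\times(0,\i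nfty)$.
   Context: Notation. $\mathbb{R}^N_+=\{x\in\mathbb{R}^N: x_N>0\}$, $e_N=(0,\dots,0,1)\in\mathbb{R}^N$, $D_i=\partial/\partial x_i$, $\nabla=(D_1,\dots,D_N)$, $\nabla'=(D_1,\dots,D_{N-1})$ (absent if $N=1$); $\operatorname{Lip}(K)$ is the space of Lipschitz continuous functions on $K$; $\nabla^\ell$ is the tensor of all spatial partial derivatives of order $\ell$; $(w)_N$ is the $N$th component of a vector $w$. For $p\in\mathbb{R}^N$, $P(p)=I_N-\frac{p\otimes p}{1+|p|^2}$. $S^{N-1}$ is the unit sphere of $\mathbb{R}^N$ and $S^{N-1}_+=S^{N-1}\cap\mathbb{R}^N_+$. For $\psi$ on $\overline{S^{N-1}_+}$, $\bar\psi(x)=|x|\psi(x/|x|)$ (with $\bar\psi(0)=0$) is its $1$-homogeneous extension to $\overline{\mathbb{R}^N_+}$. Problem (SD$_\gamma$) (surface diffusion flow for a graph, with contact angle condition, $\gamma=\tan\theta$, $|\theta|<\pi/2$, and no-flux condition): $$u_t+\operatorname{div}\Big(\sqrt{1+|\nabla u|^2}\,P(\nabla u)\nabla\operatorname{tr}\Big(\tfrac{P(\nabla u)}{\sqrt{1+|\nabla u|^2}}\nabla^2u\Big)\Big)=0\quad\text{in }\mathbb{R}^N_+\times(0,\infty),$$ $$D_Nu-\gamma(1+|\nabla'u|^2)^{1/2}=0\quad\text{on }\partial\mathbb{R}^N_+\times(0,\infty),$$ $$\Big(\sqrt{1+|\nabla u|^2}\,P(\nabla u)\nabla\operatorname{tr}\Big(\tfrac{P(\nabla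 u)}{\sqrt{1+|\nabla u|^2}}\nabla^2u\Big)\Big)_N=0\quad\text{on }\partial\mathbb{R}^N_+\times(0,\infty).$$ Solutions are classical; ''with initial data $u_0$'' means that $u$ is continuous on $\overline{\mathbb{R}^N_+}\times[0,\infty)$ with $u(\cdot,0)=u_0$. A solution $u$ is self-similar if $u^\sigma=u$ for all $\sigma>0$, where $u^\sigma(x,t)=\sigma^{-1/4}u(\sigma^{1/4}x,\sigma t)$. Function spaces. For a (scalar, vector or tensor valued) continuous function $f$ on $Q=\overline{\mathbb{R}^N_+}\times(a,b)$ and $\beta\in(0,1)$, let $[f]_{C_x^\beta(Q)}$ be the supremum of $|f(x,t)-f(y,t)|/|x-y|^\beta$ over $x\ne y$ in $\overline{\mathbb{R}^N_+}$, $t\in(a,b)$, and $[f]_{C_t^\beta(Q)}$ the supremum of $|f(x,s)-f(x,t)|/|s-t|^\beta$ over $s\neq t$ in $(a,b)$, $x\in\overline{\mathbb{R}^N_+}$. For non-integer $\lambda>0$ with integer part $\lfloor\lambda\rfloor$, with $\ell,m$ ranging over $\mathbb{Z}_{\ge0}$, set $$[f]_{C^{\lambda,\lambda/4}(Q)}=\sum_{\ell+4m=\lfloor\lambda\rfloor}[\nabla^\ell\partial_t^mf]_{C_x^{\lambda-\lfloor\lambda\rfloor}(Q)}+\sum_{\lambda-4<\ell+4m\le\lambda}[\nabla^\ell\partial_t^mf]_{C_t^{(\lambda-\ell-4m)/4}(Q)},$$ $$\|f\|'_{BC^{\lambda,\lambda/4}(Q)}=\sum_{\ell+4m\le\lambda}(b-a)^{\ell/4+m}\|\nabla^\ell\partial_t^mf\|_{L^\infty(Q)}+(b-a)^{\lambda/4}[f]_{C^{\lambda,\lambda/4}(Q)}.$$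 For $k\in\mathbb{Z}_{\ge0}$, $\mu\in(0,1)$, $Z^{k+\mu}$ is the space of $v\in C(\overline{\mathbb{R}^N_+}\times(0,\infty))$ (scalar or vector valued) with $$\|v\|_{Z^{k+\mu}}=\sup_{t>0}\|v\|'_{BC^{k+\mu,(k+\mu)/4}(\overline{\mathbb{R}^N_+}\times(t/2,t))}<\infty,$$ $\hat Z^{k+\mu}=\{v\in C(\overline{\mathbb{R}^N_+}\times(0,\infty)):\nabla v\in Z^{k+\mu}\}$, and $\hat B_{\delta^*}=\{v\in\hat Z^{4+\mu}:\|\nabla v-\gamma_0e_N\|_{Z^{4+\mu}}\le\delta^*\}$. Property (W) of $(\varepsilon^*,\delta^* )$ (for given $N,\mu,\gamma_0$; such constants exist by the paper's global existence theorem): for every $\gamma\in\mathbb{R}$ and $g\in\operatorname{Lip}(\overline{\mathbb{R}^N_+})$ with $|\gamma-\gamma_0|<\varepsilon^*$ and $\|\nabla g-\gamma_0e_N\|_{L^\infty(\mathbb{R}^N_+)}<\varepsilon^*$, the problem (SD$_\gamma$) has a unique solution $u$ in $\hat B_{\delta^*}$ with initial data $g$; moreover $u\in C^\infty(\overline{\mathbb{R}^N_+}\times(0,\infty))\cap C(\overline{\mathbb{R}^N_+}\times[0,\infty))$ and $\sup_x|\nabla^\ell\partial_t^mu(x,t)|\le Ct^{(1-\ell-4m)/4}$, $\sup_x|u(x,t)-g(x)|\le Ct^{1/4}$ for all $(\ell,m)\in\mathbb{Z}^2_{\ge0}\setminus\{(0,0)\}$, $t>0$, with $C$ depending only on $N,\gamma,\varepsilon^*,\delta^*,\ell,m$.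 By uniqueness and scale invariance, the solution in $\hat B_{\delta^*}$ with initial data $g=\bar\psi$ is self-similar; it is the function $u^{\gamma,\psi}$. *)

(* Defs.v *)
From HB Require Import structures.
From mathcomp Require Import all_boot all_order all_algebra.
From mathcomp Require Import all_classical all_reals all_analysis.

Set Implicit Arguments.
Unset Strict Implicit.
Unset Printing Implicit Defensive.

Import Order.TTheory GRing.Theory Num.Theory.
Import numFieldNormedType.Exports.

Local Open Scope classical_set_scope.
Local Open Scope ring_scope.

(* The space dimension is N = n.+1; points of R^N are column vectors and the
   N-th coordinate has index ord_max.  The library norm `|x| on column vectors
   is the sup norm, hence the explicit Euclidean norm enorm below.
   Functions of (x, t) are defined on all of R^N * R; only their values for x
   in the closed half-space (and t >= 0 or t > 0) are ever used. *)

Section Geometry.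
Variables (R : realType) (n : nat).
Notation V := ('cV[R]_n.+1).

Definition fnorm (I : finType) (T : {ffun I -> R}) : R :=
  Num.sqrt (\sum_i T i ^+ 2).

Definition enorm (x : V) : R := Num.sqrt (\sum_i x i 0 ^+ 2).

Definition basis_vec (i : 'I_n.+1) : V := delta_mx i 0.

Definition e_N : V := basis_vec ord_max.

Definition half_space : set V := [set x | 0 < x ord_max 0].

Definition closed_half_space : set V := [set x | 0 <= x ord_max 0].

Definition half_sphere : set V := [set x | enorm x = 1 /\ half_space x].

Definition closed_half_sphere : set V :=
  [set x | enorm x = 1 /\ closed_half_space x].

Definition Lip (K : set V) (f : V -> R) : Prop :=
  exists L : R, forall x y, K x -> K y -> `|f x - f y| <= L * enorm (x - y).

Definition hom_ext (psi : V -> R) (x : V) : R :=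
  enorm x * psi ((enorm x)^-1 *: x).

(* Lebesgue null sets of R^N: countable covers by closed boxes of arbitrarily
   small total volume. *)
Definition lebesgue_null (A : set V) : Prop :=
  forall e : R, 0 < e -> exists a b : nat -> V,
    [/\ forall k i, a k i 0 <= b k i 0,
        A `<=` \bigcup_k [set x : V | forall i, a k i 0 <= x i 0 <= b k i 0] &
        (\sum_(0 <= k <oo) (\prod_i (b k i 0 - a k i 0))%:E <= e%:E)%E].

(* Essential supremum of |h| over Omega for the Lebesgue measure. *)
Definition Linfty_norm (Omega : set V) (h : V -> V) : \bar R :=
  ereal_inf
    [set y : \bar R |
       lebesgue_null (Omega `&` [set x | (y < (enorm (h x))%:E)%E])].

End Geometry.

Section Derivatives.
Variables (R : realType) (n : nat).
Notation V := ('cV[R]_n.+1).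
Notation ST := (V * R)%type.

Definition diff_quotient (i : 'I_n.+1) (g : V -> R) (x : V) (h : R) : R :=
  h^-1 * (g (x + h *: basis_vec R i) - g x).

(* Increments h for which x + h e_i stays in the closed half-space: the usual
   punctured neighbourhoods of 0 when x is interior or i < N, and the right
   neighbourhoods of 0 when i = N and x is on the boundary. *)
Definition increments (i : 'I_n.+1) (x : V) : set_system R :=
  within [set h | closed_half_space (x + h *: basis_vec R i)] (0 : R)^'.

(* Partial derivative D_i on the closed half-space (one-sided normal
   derivative on the boundary). *)
Definition partial (i : 'I_n.+1) (g : V -> R) (x : V) : R :=
  lim (diff_quotient i g x @ increments i x).

Definition partial_exists (i : 'I_n.+1) (g : V -> R) (x : V) : Prop :=
  cvg (diff_quotient i g x @ increments i x).

Definition grad0 (g : V -> R) (x : V) : V := \col_i partial i g x.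

Definition Dx (i : 'I_n.+1) (f : ST -> R) (z : ST) : R :=
  partial i (fun y => f (y, z.2)) z.1.

Definition Dt (f : ST -> R) (z : ST) : R :=
  derive1 (fun s : R => f (z.1, s)) z.2.

(* D_{i_1} ... D_{i_l} dt^m f for s = [:: i_1; ...; i_l]. *)
Definition partials (s : seq 'I_n.+1) (m : nat) (f : ST -> R) : ST -> R :=
  foldr Dx (iter m Dt f) s.

(* Existence at z of the outermost derivative in partials s m f. *)
Definition partials_exist (s : seq 'I_n.+1) (m : nat) (f : ST -> R) (z : ST) :
    Prop :=
  match s, m with
  | i :: s', _ => partial_exists i (fun y => partials s' m f (y, z.2)) z.1
  | [::], m'.+1 =>
    derivable (fun tau : R => partials [::] m' f (z.1, tau)) z.2 1
  | [::], 0%N => True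
  end.

(* nabla^l dt^m f exists and is continuous on Q for all (l, m) satisfying P;
   P is always used with a downward closed set of pairs. *)
Definition has_cont_derivs (P : nat -> nat -> bool) (Q : set ST)
    (f : ST -> R) : Prop :=
  forall s m, P (size s) m ->
    (forall z, Q z -> partials_exist s m f z) /\
    {within Q, continuous (partials s m f)}.

Definition nabla (l m : nat) (f : ST -> R) (z : ST) :
    {ffun l.-tuple 'I_n.+1 -> R} :=
  [ffun s : l.-tuple 'I_n.+1 => partials s m f z].

Definition nabla_vec (l m : nat) (f : ST -> V) (z : ST) :
    {ffun 'I_n.+1 * l.-tuple 'I_n.+1 -> R} :=
  [ffun p : 'I_n.+1 * l.-tuple 'I_n.+1 =>
     partials p.2 m (fun w => f w p.1 0) z].

Definition grad (f : ST -> R) (z : ST) : V := \col_i Dx i f z.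

Definition hess (f : ST -> R) (z : ST) : 'M[R]_n.+1 :=
  \matrix_(i, j) Dx i (Dx j f) z.

Definition div (F : ST -> V) (z : ST) : R :=
  \sum_i Dx i (fun w => F w i 0) z.

Definition Q_open : set ST := closed_half_space (n := n) `*` [set` `]0, +oo[].

Definition Q_closed : set ST :=
  closed_half_space (n := n) `*` [set` `[0, +oo[].

End Derivatives.

Section SurfaceDiffusion.
Variables (R : realType) (n : nat).
Notation V := ('cV[R]_n.+1).
Notation ST := (V * R)%type.

Definition Pmx (p : V) : 'M[R]_n.+1 :=
  1%:M - (1 + enorm p ^+ 2)^-1 *: (p *m p^T).

Definition area (p : V) : R := Num.sqrt (1 + enorm p ^+ 2).

Definition curvature (u : ST -> R) (z : ST) : R :=
  \tr (((area (grad u z))^-1 *: Pmx (grad u z)) *m hess u z).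

Definition flux (u : ST -> R) (z : ST) : V :=
  area (grad u z) *: (Pmx (grad u z) *m grad (curvature u) z).

Record SD_solution (gamma : R) (u : ST -> R) : Prop := {
  SD_classical :
    has_cont_derivs (fun l m => (l + 4 * m <= 4)%N) (@Q_open R n) u ;
  SD_equation : forall x t, half_space x -> 0 < t ->
    Dt u (x, t) + div (flux u) (x, t) = 0 ;
  SD_contact_angle : forall (x : V) t, x ord_max 0 = 0 -> 0 < t ->
    Dx ord_max u (x, t) -
      gamma * Num.sqrt (1 + \sum_(i | i != ord_max) Dx i u (x, t) ^+ 2) = 0 ;
  SD_no_flux : forall (x : V) t, x ord_max 0 = 0 -> 0 < t ->
    flux u (x, t) ord_max 0 = 0
}.

Definition initial_data (g : V -> R) (u : ST -> R) : Prop :=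
  {within @Q_closed R n, continuous u} /\
  forall x, closed_half_space x -> u (x, 0) = g x.

Definition rescale (sigma : R) (u : ST -> R) (z : ST) : R :=
  sigma `^ (- (1 / 4)) * u (sigma `^ (1 / 4) *: z.1, sigma * z.2).

Definition self_similar (u : ST -> R) : Prop :=
  forall sigma, 0 < sigma -> forall z, Q_closed z -> rescale sigma u z = u z.

End SurfaceDiffusion.

(* Norms of vector valued functions on closed_half_space * ]a, b[, with values
   in \bar R.  The non-integer exponent is lambda = k + mu with k its integer
   part and mu in ]0, 1[. *)
Section FunctionSpaces.
Variables (R : realType) (n : nat).
Notation V := ('cV[R]_n.+1).
Notation ST := (V * R)%type.

Definition slab (a b : R) : set ST :=
  closed_half_space (n := n) `*` [set` `]a, b[].

(* Only used for continuous f, for which it is the L^infty norm on the slab. *)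
Definition sup_norm (I : finType) (a b : R) (f : ST -> {ffun I -> R}) :
    \bar R :=
  ereal_sup [set (fnorm (f z))%:E | z in slab a b].

Definition holder_x (I : finType) (beta a b : R) (f : ST -> {ffun I -> R}) :
    \bar R :=
  ereal_sup [set e | exists x y t,
    [/\ slab a b (x, t), slab a b (y, t), x <> y &
        e = (fnorm (f (x, t) - f (y, t)) / enorm (x - y) `^ beta)%:E]].

Definition holder_t (I : finType) (beta a b : R) (f : ST -> {ffun I -> R}) :
    \bar R :=
  ereal_sup [set e | exists x s t,
    [/\ slab a b (x, s), slab a b (x, t), s <> t &
        e = (fnorm (f (x, s) - f (x, t)) / `|s - t| `^ beta)%:E]].

Definition holder_seminorm (k : nat) (mu a b : R) (f : ST -> V) : \bar R :=
  (\sum_(l < k.+1) \sum_(m < k.+1 | (l + 4 * m == k)%N)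
     holder_x mu a b (nabla_vec l m f) +
   \sum_(l < k.+1)
     \sum_(m < k.+1 | (k%:R + mu - 4 < (l + 4 * m)%:R <= k%:R + mu)%R)
     holder_t ((k%:R + mu - l%:R - 4 * m%:R) / 4)%R a b (nabla_vec l m f))%E.

Definition BC_norm (k : nat) (mu a b : R) (f : ST -> V) : \bar R :=
  (\sum_(l < k.+1) \sum_(m < k.+1 | ((l + 4 * m)%:R <= k%:R + mu)%R)
     ((b - a) `^ (l%:R / 4 + m%:R))%R%:E * sup_norm a b (nabla_vec l m f) +
   ((b - a) `^ ((k%:R + mu) / 4))%R%:E * holder_seminorm k mu a b f)%E.

Definition Z_norm (k : nat) (mu : R) (v : ST -> V) : \bar R :=
  ereal_sup [set BC_norm k mu (t / 2) t v | t in [set` `]0, +oo[]].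

Definition in_Z (k : nat) (mu : R) (v : ST -> V) : Prop :=
  (forall i, has_cont_derivs (fun l m => (l + 4 * m <= k)%N) (@Q_open R n)
               (fun z => v z i 0)) /\
  (Z_norm k mu v < +oo)%E.

Definition in_hatZ (k : nat) (mu : R) (v : ST -> R) : Prop :=
  [/\ {within @Q_open R n, continuous v},
      forall i (x : V) t, Q_open (x, t) ->
        partial_exists i (fun y => v (y, t)) x &
      in_Z k mu (grad v)].

Definition in_hatB (mu gamma0 delta : R) (v : ST -> R) : Prop :=
  in_hatZ 4 mu v /\
  (Z_norm 4 mu (fun z => (grad v z - gamma0 *: e_N R n)%R) <= delta%:E)%E.

(* u is a solution in hatB_delta with initial data g. *)
Definition solution_in_hatB (mu gamma0 delta gamma : R) (g : V -> R)
    (u : ST -> R) : Prop :=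
  [/\ in_hatB mu gamma0 delta u, SD_solution gamma u & initial_data g u].

(* Used for Lipschitz g (or hom_ext of a Lipschitz function), whose gradient
   exists almost everywhere by Rademacher's theorem. *)
Definition grad_close (gamma0 eps : R) (g : V -> R) : Prop :=
  (Linfty_norm (@half_space R n)
     (fun x => (grad0 g x - gamma0 *: e_N R n)%R) < eps%:E)%E.

Definition admissible_data (gamma0 eps : R) (g : V -> R) : Prop :=
  Lip (@closed_half_space R n) g /\ grad_close gamma0 eps g.

(* The constant C of the decay estimates depends on gamma, l, m (and on the
   fixed parameters), but not on g. *)
Definition well_posed (mu gamma0 eps delta : R) : Prop :=
  forall gamma : R, `|gamma - gamma0| < eps ->
  [/\ forall g, admissible_data gamma0 eps g ->
        exists u, solution_in_hatB mu gamma0 delta gamma g u /\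
          forall v, solution_in_hatB mu gamma0 delta gamma g v ->
            forall z, Q_closed z -> v z = u z,
      forall g u, admissible_data gamma0 eps g ->
        solution_in_hatB mu gamma0 delta gamma g u ->
        has_cont_derivs (fun _ _ => true) (@Q_open R n) u &
      forall l m : nat, (l, m) != (0, 0)%N ->
        exists C : R, forall g u, admissible_data gamma0 eps g ->
          solution_in_hatB mu gamma0 delta gamma g u ->
          forall x t, closed_half_space x -> 0 < t ->
            fnorm (nabla l m u (x, t)) <=
              C * t `^ ((1 - l%:R - 4 * m%:R) / 4) /\
            `|u (x, t) - g x| <= C * t `^ (1 / 4)].

End FunctionSpaces.

(* Main.v *)
(* Compactness and uniqueness. Write u^sigma for the rescaled solution. The decay
   estimates are scale invariant, so all derivatives of u^sigma are bounded on
   slabs a <= t <= b with 0 < a, uniformly in sigma. Let U be an ultrafilter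
   finer than the filter sigma -> +oo. Bounded real functions converge along U,
   hence every derivative of u^sigma has a pointwise limit, with no extraction of
   subsequences; uniform second order Taylor bounds show that the limits are the
   derivatives of w = lim_U u^sigma. The equation and the boundary conditions pass
   to the limit, the Z-norm is scale invariant and lower semicontinuous, and
   w(., 0) = lim u0(sigma^(1/4) x) / sigma^(1/4) is the 1-homogeneous extension of
   psi. By uniqueness w is the self-similar solution v. As U is arbitrary,
   u^sigma -> v pointwise, and equicontinuity makes the convergence uniform on
   compact sets. *)

Require Import Defs.
From mathcomp Require Import all_boot all_order all_algebra.
From mathcomp Require Import all_classical all_reals all_analysis.
From mathcomp Require Import ring lra zify.

Import Order.TTheory GRing.Theory Num.Theory.
Import numFieldNormedType.Exports.

Local Open Scope classical_set_scope.
Local Open Scope ring_scope.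

Set Implicit Arguments.
Unset Strict Implicit.
Unset Printing Implicit Defensive.

(** * Dilations of the half-space *)

(** Two features of the definitions shape the proof. A derivative is the [lim] of a difference
    quotient, one-sided in the normal direction on the boundary and a default value if it diverges,
    so a passage to the limit has to yield existence as well as the value. The estimates are
    therefore kept as non-strict inequalities between increments, which survive pointwise limits.
    Moreover [partials] takes time derivatives first and space derivatives afterwards, whereas the
    Z-norm involves time derivatives of the gradient; a Schwarz theorem valid up to the boundary
    mediates between the two orders. The initial time is out of reach of the derivative bounds,
    since the one for the time derivative blows up there; the bound of u - u0 by a multiple of
    t^(1/4) fills the gap. Finally, uniqueness can be invoked only once the 1-homogeneous extension
    of psi is known to be admissible; its Lipschitz bound is inherited from the blow-downs of u0. *)

Section Scaling.
Variable R : realType.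

Lemma scale_cancel (a b h X : R) : b != 0 ->
  h^-1 * (a * X) = a * b * (b^-1 / h * X).
Proof. by move=> b0; rewrite -!mulrA mulVKf // mulrCA. Qed.

(* No convergence is assumed for the equality: both limits of a divergent
   quotient are the junk value 0. *)
Lemma lim_scale (F G : set_system R) (q : R -> R) (a b : R) :
  ProperFilter F -> ProperFilter G -> a != 0 -> b != 0 ->
  (b * h) @[h --> F] --> G -> (b^-1 * h) @[h --> G] --> F ->
  (cvg (q @ G) -> cvg ((a * q (b * h)) @[h --> F])) /\
  lim ((a * q (b * h)) @[h --> F]) = a * lim (q @ G).
Proof.
move=> FF FG a0 b0 FG1 GF1.
have fwd : cvg (q @ G) -> (a * q (b * h)) @[h --> F] --> a * lim (q @ G).
  move=> cq; apply: cvgM; first exact: cvg_cst.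
  exact: (cvg_comp _ _ FG1 cq).
split=> [/fwd|]; first by move=> h; apply/cvg_ex; eexists; exact: h.
have [cq|ncq] := pselect (cvg (q @ G)); first by apply/cvg_lim => //; exact: fwd.
rewrite (dvgP ncq) dvgP ?mulr0 // => cF; apply: ncq.
have -> : q = fun h => a^-1 * (a * q (b * (b^-1 * h))).
  by apply/funext => h; rewrite !mulrA mulVf // mul1r divff // mul1r.
apply: is_cvgM; first exact: is_cvg_cst.
apply/cvg_ex; exists (lim ((a * q (b * h)) @[h --> F])).
exact: (cvg_comp _ _ GF1 cF).
Qed.

Variable n : nat.
Notation V := 'cV[R]_n.+1.
Notation ST := (V * R)%type.

Lemma increments_scale i (x : V) (b : R) : 0 < b ->
  (b * h) @[h --> increments i x] --> increments i (b *: x).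
Proof.
move=> b0 A; rewrite /increments /= /within /= => AA.
have : \forall h \near (0 : R), b * h != 0 ->
    closed_half_space (b *: x + (b * h) *: basis_vec R i) -> A (b * h).
  have bc : (b * h) @[h --> (0:R)] --> (0 : R).
    by rewrite -[X in _ --> X](mulr0 b); apply: cvgM; [exact: cvg_cst|exact: cvg_id].
  exact: (bc _ AA).
apply: filterS => h Hh h0 xh; apply: Hh; first by rewrite mulf_neq0 // gt_eqF.
by rewrite -scalerA -scalerDr /closed_half_space /= mxE mulr_ge0 // ltW.
Qed.

(** Positive increments never leave the closed half-space, whatever the direction, so the filter is
    proper on the boundary too. *)
Lemma increments_proper i (x : V) : closed_half_space x ->
  ProperFilter (increments i x).
Proof.
move=> xH; apply: Build_ProperFilter_ex => A.
rewrite /increments /within /= => /nbhs_ballP [e /= e0 eA].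
exists (e / 2); apply: (eA (e / 2)); last 2 first.
- by rewrite gt_eqF // divr_gt0.
- rewrite /closed_half_space /= !mxE addr_ge0 // mulr_ge0 ?ler0n //.
  by rewrite ltW // divr_gt0.
by rewrite /ball /= sub0r normrN gtr0_norm ?divr_gt0 // ltr_pdivrMr // mulr_natr mulr2n ltrDl.
Qed.

Lemma increments_filter i (x : V) : Filter (increments i x).
Proof. exact: within_filter. Qed.

Lemma increments_mem i (x : V) :
  increments i x [set h | h != 0 /\ closed_half_space (x + h *: basis_vec R i)].
Proof. exact: (@filterE _ (nbhs (0 : R)) _ _ (fun h h0 xh => conj h0 xh)). Qed.

(** Three independent factors make the class stable under differentiation: [Dx] turns c into c * b
    and [Dt] turns c into c * tau. [rescale sigma] is the case c = sigma^(-1/4), b = sigma^(1/4),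
    tau = sigma. *)
Definition dilate (c b tau : R) (f : ST -> R) (z : ST) : R :=
  c * f (b *: z.1, tau * z.2).

Lemma diff_quotient_scale i (g : V -> R) (c b : R) (x : V) (h : R) : b != 0 ->
  diff_quotient i (fun y => c * g (b *: y)) x h =
  (c * b) * diff_quotient i g (b *: x) (b * h).
Proof.
move=> b0; rewrite /diff_quotient scalerDr scalerA -mulrBr invfM.
set X := (X in h^-1 * (c * X)).
exact: scale_cancel.
Qed.

Lemma closed_half_spaceZ (b : R) (x : V) : 0 < b ->
  closed_half_space x -> closed_half_space (b *: x).
Proof. by move=> b0; rewrite /closed_half_space /= mxE => ?; rewrite mulr_ge0 // ltW. Qed.

Lemma partial_scale i (g : V -> R) (c b : R) (x : V) : c != 0 -> 0 < b ->
  closed_half_space x ->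
  (partial_exists i g (b *: x) -> partial_exists i (fun y => c * g (b *: y)) x) /\
  partial i (fun y => c * g (b *: y)) x = c * b * partial i g (b *: x).
Proof.
move=> c0 b0 xH; have b0' : b != 0 by rewrite gt_eqF.
have := @lim_scale (increments i x) (increments i (b *: x))
  (diff_quotient i g (b *: x)) (c * b) b (increments_proper i xH)
  (increments_proper i (closed_half_spaceZ b0 xH)).
rewrite /partial_exists /partial.
rewrite (_ : diff_quotient i (fun y => c * g (b *: y)) x =
  fun h => c * b * diff_quotient i g (b *: x) (b * h)); last first.
  by apply/funext => h; rewrite diff_quotient_scale.
move=> H; apply: H => //; first by rewrite mulf_neq0.
- exact: increments_scale.
- have /= := @increments_scale i (b *: x) b^-1.
  rewrite scalerA mulVf // scale1r invr_gt0; exact.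
Qed.

Lemma partial_ext i (f g : V -> R) (x : V) :
  {in @closed_half_space R n, f =1 g} -> closed_half_space x ->
  (partial_exists i f x -> partial_exists i g x) /\
  partial i f x = partial i g x.
Proof.
move=> fg xH; have e : diff_quotient i f x h @[h --> increments i x] =
    diff_quotient i g x h @[h --> increments i x].
  have FF := @increments_filter i x.
  apply/seteqP; split=> A; rewrite /fmap /=;
    apply: filterS2 (increments_mem i x) => h [_ xh]; 
    by rewrite /preimage /= /diff_quotient !fg ?inE.
by rewrite /partial_exists /partial e.
Qed.

Lemma Dx_ext i (f g : ST -> R) (z : ST) :
  (forall y, closed_half_space y -> f (y, z.2) = g (y, z.2)) ->
  closed_half_space z.1 -> Dx i f z = Dx i g z.
Proof.
move=> fg zH; rewrite /Dx; apply: (proj2 (@partial_ext i _ _ z.1 _ zH)).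
by move=> y; rewrite inE => /fg.
Qed.

Lemma Dx_dilate i (f : ST -> R) (c b tau : R) z : c != 0 -> 0 < b ->
  closed_half_space z.1 ->
  Dx i (dilate c b tau f) z = dilate (c * b) b tau (Dx i f) z.
Proof.
move=> c0 b0 zH; rewrite /Dx /dilate /=.
exact: (proj2 (@partial_scale i (fun y => f (y, tau * z.2)) c b z.1 c0 b0 zH)).
Qed.

Lemma derive1_scale (f : R -> R) (c tau t : R) : c != 0 -> tau != 0 ->
  (derivable f (tau * t) 1 -> derivable (fun s => c * f (tau * s)) t 1) /\
  derive1 (fun s => c * f (tau * s)) t = c * tau * derive1 f (tau * t).
Proof.
move=> c0 t0.
have sc (a : R) : a != 0 -> (a * h) @[h --> 0^'] --> (0 : R)^'.
  move=> a0 A; rewrite /dnbhs /= /within /= => AA.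
  have bc : (a * h) @[h --> (0:R)] --> (0 : R).
    by rewrite -[X in _ --> X](mulr0 a); apply: cvgM; [exact: cvg_cst|exact: cvg_id].
  exact: (@filterS _ (nbhs (0 : R)) _ _ _ (fun h Hh h0 => Hh (mulf_neq0 a0 h0)) (bc _ AA)).
pose q (h : R) := h^-1 *: (f (h + tau * t) - f (tau * t)).
have qE h : h^-1 *: (c * f (tau * (h + t)) - c * f (tau * t)) =
    c * tau * q (tau * h).
  rewrite /q mulrDr -mulrBr invfM /GRing.scale /=; set X := (X in h^-1 * (c * X)).
exact: scale_cancel.
have [H1 H2] := @lim_scale 0^' 0^' q (c * tau) tau _ _ (mulf_neq0 c0 t0) t0
  (sc _ t0) (sc _ (invr_neq0 t0)).
split; rewrite ?/derivable ?/derive1.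
- move=> H; rewrite [X in cvg (X @ _)](_ : _ = fun h => c * tau * q (tau * h)).
    apply: H1; rewrite (_ : q = fun h : R =>
      h^-1 *: ((f \o shift (tau * t)) (h *: 1) - f (tau * t))) //.
    by apply/funext => h; rewrite /q /= [h *: 1]mulr1.
  by apply/funext => h; rewrite -qE /= [h *: 1]mulr1.
- rewrite -[RHS]H2; congr (lim _); rewrite (_ : (fun h : R => h^-1 *: _) = fun h => c * tau * q (tau * h)) //; apply/funext => h; exact: qE.
Qed.

Lemma Dt_dilate (f : ST -> R) (c b tau : R) : c != 0 -> tau != 0 ->
  Dt (dilate c b tau f) = dilate (c * tau) b tau (Dt f).
Proof.
move=> c0 t0; apply/funext => z; rewrite /Dt /dilate /=.
exact: (proj2 (@derive1_scale (fun s => f (b *: z.1, s)) c tau z.2 c0 t0)).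
Qed.

Lemma iter_Dt_dilate m (f : ST -> R) (c b tau : R) : c != 0 -> tau != 0 ->
  iter m (@Dt R n) (dilate c b tau f) = dilate (c * tau ^+ m) b tau (iter m (@Dt R n) f).
Proof.
move=> c0 t0; elim: m => [|m IH]; first by rewrite expr0 mulr1.
by rewrite /= IH Dt_dilate ?mulf_neq0 ?expf_neq0 // exprSr mulrA.
Qed.

(** No differentiability of f is assumed: by [lim_scale] the identity also holds between default
    values. *)
Lemma partials_dilate s m (f : ST -> R) (c b tau : R) z :
  c != 0 -> 0 < b -> tau != 0 -> closed_half_space z.1 ->
  partials s m (dilate c b tau f) z =
  dilate (c * b ^+ size s * tau ^+ m) b tau (partials s m f) z.
Proof.
move=> c0 b0 t0; have b0' : b != 0 by rewrite gt_eqF.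
rewrite /partials iter_Dt_dilate //.
elim: s z => [|i s IH] z zH /=; first by rewrite expr0 mulr1.
rewrite (@Dx_ext i _ (dilate (c * b ^+ size s * tau ^+ m) b tau
  (foldr (@Dx R n) (iter m (@Dt R n) f) s))) //; last by move=> y yH; rewrite IH.
rewrite Dx_dilate // ?mulf_neq0 ?expf_neq0 //.
rewrite (_ : c * b ^+ size s * tau ^+ m * b = c * b ^+ (size s).+1 * tau ^+ m) //.
by rewrite exprSr !mulrA mulrAC.
Qed.

Lemma partials_exist_dilate s m (f : ST -> R) (c b tau : R) (z : ST) :
  c != 0 -> 0 < b -> tau != 0 -> closed_half_space z.1 ->
  partials_exist s m f (b *: z.1, tau * z.2) ->
  partials_exist s m (dilate c b tau f) z.
Proof.
move=> c0 b0 t0 zH; have b0' : b != 0 by rewrite gt_eqF.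
case: s => [|i s] /=; last first.
  move=> H; have a0 : c * b ^+ size s * tau ^+ m != 0.
    by rewrite ?mulf_neq0 ?expf_neq0.
  have := proj1 (@partial_scale i (fun y => partials s m f (y, tau * z.2))
    _ b z.1 a0 b0 zH) H.
  apply: (proj1 (@partial_ext i _ _ z.1 _ zH)).
  by move=> y; rewrite inE => yH; rewrite partials_dilate.
case: m => // m H.
have a0 : c * tau ^+ m != 0 by rewrite ?mulf_neq0 ?expf_neq0.
have := proj1 (@derive1_scale (fun s => partials [::] m f (b *: z.1, s)) _ tau z.2 a0 t0) H.
by rewrite /partials /= iter_Dt_dilate.
Qed.

End Scaling.

(** * Mean value and Taylor estimates for one-sided partial derivatives *)

Section Calculus.
Variables (R : realType) (n : nat).
Notation V := 'cV[R]_n.+1.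
Notation ST := (V * R)%type.
Notation H := (@closed_half_space R n).
Notation e_ i := (basis_vec R i).

Lemma cvg_dist_le (T : Type) (F : set_system T) (f : T -> R) (l c e : R) :
  ProperFilter F -> f @ F --> l -> (\forall k \near F, `|f k - c| <= e) ->
  `|l - c| <= e.
Proof.
move=> FF fl fc; apply/ler_addgt0Pr => d d0.
have [k [h1 h2]] := filter_ex (filterI fc ((cvgrPdist_lt _ _).1 fl d d0)).
rewrite (_ : l - c = (f k - c) + (l - f k)); last by ring.
by apply: (le_trans (ler_normD _ _)); rewrite lerD // ltW.
Qed.

Lemma partial_cvg i (g : V -> R) x : partial_exists i g x ->
  diff_quotient i g x h @[h --> increments i x] --> partial i g x.
Proof. by []. Qed.

Lemma partial_eq i (g : V -> R) x a : H x ->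
  diff_quotient i g x h @[h --> increments i x] --> a ->
  partial_exists i g x /\ partial i g x = a.
Proof.
move=> xH ga; have FF := @increments_proper R n i x xH.
by split; [apply/cvg_ex; exists a|apply/cvg_lim].
Qed.

(** This form of differentiability involves no division and no strict inequality, so it can be
    checked on pointwise limits of functions. *)
Lemma partial_crit i (g : V -> R) x a : H x ->
  (forall e, 0 < e -> \forall h \near increments i x,
    `|g (x + h *: e_ i) - g x - a * h| <= e * `|h|) ->
  partial_exists i g x /\ partial i g x = a.
Proof.
move=> xH gx; apply: partial_eq => //; have FF := @increments_proper R n i x xH.
apply/cvgrPdist_le => e e0; apply: filterS2 (gx e e0) (increments_mem i x).
move=> h /= gh [h0 _]; rewrite distrC /diff_quotient.
rewrite (_ : _ - a = h^-1 * (g (x + h *: e_ i) - g x - a * h)); last by field.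
by rewrite normrM normfV ler_pdivrMl ?normr_gt0 // (mulrC `|h| e).
Qed.

Lemma derive1_crit (f : R -> R) t a :
  (forall e, 0 < e -> \forall h \near (0 : R),
    `|f (t + h) - f t - a * h| <= e * `|h|) ->
  derivable f t 1 /\ derive1 f t = a.
Proof.
move=> ft.
have ca : h^-1 *: (f (h + t) - f t) @[h --> 0^'] --> a.
  apply/cvgrPdist_le => e e0; have P := ft e e0.
  near=> h; have h0 : h != 0 by near: h; exact: nbhs_dnbhs_neq.
  have fh : `|f (t + h) - f t - a * h| <= e * `|h|.
    by near: h; exact: nbhs_dnbhs.
  rewrite distrC /GRing.scale /=.
  rewrite (_ : _ - a = h^-1 * (f (t + h) - f t - a * h)); last first.
    by rewrite (addrC t); field.
  by rewrite normrM normfV ler_pdivrMl ?normr_gt0 // (mulrC `|h| e).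
split; last by apply/cvg_lim.
apply/cvg_ex; exists a; move: ca; apply: cvg_trans.
rewrite (_ : (fun h : R => h^-1 *: ((f \o shift t) (h *: 1) - f t)) =
  fun h => h^-1 *: (f (h + t) - f t)) //.
by apply/funext => h; rewrite /= [h *: 1]mulr1.
Unshelve. all: by end_near.
Qed.

Lemma segment_in i (x : V) h s : H x -> H (x + h *: e_ i) -> 0 <= s <= h ->
  H (x + s *: e_ i).
Proof.
rewrite /closed_half_space /= !mxE => x0 xh sh.
by case: (_ == _) xh; rewrite /= ?mulr1 ?mulr0; lra.
Qed.

Lemma increments_ball i (x : V) (A : set R) : increments i x A <->
  exists2 d, 0 < d & forall h, `|h| < d -> h != 0 -> H (x + h *: e_ i) -> A h.
Proof.
rewrite /increments /within /= /dnbhs /within /=; split.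
  move=> /nbhs_ballP[d /= d0 dA]; exists d => // h hd; apply: dA.
  by rewrite /ball /= sub0r normrN.
move=> [d d0 dA]; apply/nbhs_ballP; exists d => // h.
by rewrite /ball /= sub0r normrN; exact: dA.
Qed.

(** Strictly inside a segment of the half-space, small increments of both signs are admissible, so
    the possibly one-sided derivative is an ordinary one along the line. *)
Lemma line_derive i (g : V -> R) (x : V) h s : H x -> H (x + h *: e_ i) ->
  0 < s < h -> partial_exists i g (x + s *: e_ i) ->
  is_derive s 1 (fun s => g (x + s *: e_ i)) (partial i g (x + s *: e_ i)).
Proof.
move=> xH xh /andP[s0 sh] /partial_cvg.
set D := partial i g _ => gD.
have qD : k^-1 *: (((fun s => g (x + s *: e_ i)) \o shift s) (k *: 1) -
    g (x + s *: e_ i)) @[k --> 0^'] --> D.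
  move=> A AD; have [d d0 dA] := (increments_ball _ _ _).1 (gD _ AD).
  apply/nbhs_ballP; exists (Num.min d (Num.min s (h - s))).
    by rewrite /= !lt_min d0 s0 subr_gt0.
  move=> k; rewrite /ball /= sub0r normrN !lt_min !ltr_norml => kd k0.
  have := dA k; rewrite /preimage /= /diff_quotient -addrA -scalerDl [k *: 1]mulr1.
  rewrite (addrC s); apply => //.
    by rewrite ltr_norml; case/andP: kd.
  by apply: (segment_in xH xh); apply/andP; split; lra.
by apply: DeriveDef; [apply/cvg_ex; exists D|apply/cvg_lim].
Qed.

(** Near 0 the difference quotient is bounded by |D| + 1. The mean value theorem needs this
    continuity at the endpoints of a segment, where [line_derive] says nothing. *)
Lemma partial_continuous i (g : V -> R) x : H x -> partial_exists i g x ->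
  forall e, 0 < e -> exists2 d, 0 < d &
  forall h, `|h| < d -> H (x + h *: e_ i) -> `|g (x + h *: e_ i) - g x| < e.
Proof.
move=> xH /partial_cvg; set D := partial i g _ => gD e e0.
have FF := @increments_proper R n i x xH.
have [d d0 dA] := (increments_ball _ _ _).1 ((cvgrPdist_lt _ _).1 gD 1 ltr01).
have M0 : 0 < `|D| + 1 by rewrite ltr_wpDl.
exists (Num.min d (e / (`|D| + 1))); first by rewrite lt_min d0 divr_gt0.
move=> h; rewrite lt_min => /andP[hd he] xh.
have [->|h0] := eqVneq h 0; first by rewrite scale0r addr0 subrr normr0.
have := dA h hd h0 xh; rewrite distrC /diff_quotient => q.
have qM : `|h^-1 * (g (x + h *: e_ i) - g x)| < `|D| + 1.
  rewrite -[X in `|X|](subrK D) (le_lt_trans (ler_normD _ _)) // addrC.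
  by rewrite ltrD2l.
rewrite -(mulVKf h0 (g _ - g x)) normrM.
move: he; rewrite ltr_pdivlMr //; apply: le_lt_trans.
by rewrite ler_wpM2l // ltW.
Qed.

Lemma partial_mvt_pos i (g : V -> R) x (h : R) : 0 < h -> H x -> H (x + h *: e_ i) ->
  (forall y, H y -> partial_exists i g y) ->
  exists c, [/\ 0 <= c <= h, H (x + c *: e_ i) &
    g (x + h *: e_ i) - g x = partial i g (x + c *: e_ i) * h].
Proof.
move=> h0 xH xh gx.
have [||c ch E] := @MVT R (fun s => g (x + s *: e_ i))
   (fun s => partial i g (x + s *: e_ i)) 0 h h0.
- move=> s; rewrite in_itv /= => sh; apply: (line_derive xH xh sh).
  by apply/gx/(segment_in xH xh); case/andP: sh => ? ?; apply/andP; split; lra.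
- apply/subspace_continuousP => s /=; rewrite in_itv /= => sh.
  have yH := segment_in xH xh sh.
  apply/cvgrPdist_lt => e e0.
  have [d d0 dg] := partial_continuous yH (gx _ yH) e0.
  apply/nbhs_ballP; exists d => // s'; rewrite /ball /= distrC => ss'.
  rewrite in_itv /= => sh'; have := dg _ ss'.
  rewrite -addrA -scalerDl (addrC s) subrK distrC; apply; exact: (segment_in xH xh).
move: ch; rewrite in_itv /= => /andP[c0 ch].
have ch' : 0 <= c <= h by rewrite !ltW.
exists c; split => //; first exact: (segment_in xH xh).
by move: E; rewrite scale0r addr0 subr0.
Qed.

Lemma partial_mvt i (g : V -> R) x (h : R) : H x -> H (x + h *: e_ i) ->
  (forall y, H y -> partial_exists i g y) ->
  exists c, [/\ `|c| <= `|h|, H (x + c *: e_ i) &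
    g (x + h *: e_ i) - g x = partial i g (x + c *: e_ i) * h].
Proof.
move=> xH xh gx; have [h0|h0|->] := ltgtP h 0; last 2 first.
- have [c [/andP[c0 ch] ? ?]] := partial_mvt_pos h0 xH xh gx.
  by exists c; split => //; rewrite !ger0_norm // ltW.
- by exists 0; rewrite scale0r addr0 subrr mulr0.
have [||||c [/andP[c0 ch] yH E]] := @partial_mvt_pos i g (x + h *: e_ i) (- h).
- by rewrite oppr_gt0.
- by [].
- by rewrite -addrA -scalerDl subrr scale0r addr0.
- exact: gx.
move: E yH; rewrite -!addrA -!scalerDl subrr scale0r addr0 => E yH.
exists (h + c); split => //.
  by rewrite !ler0_norm; lra.
by rewrite -opprB E mulrN opprK.
Qed.

Lemma partial_lip i (g : V -> R) M : (forall y, H y -> partial_exists i g y) ->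
  (forall y, H y -> `|partial i g y| <= M) -> forall x (h : R), H x ->
  H (x + h *: e_ i) -> `|g (x + h *: e_ i) - g x| <= M * `|h|.
Proof.
move=> gx gM x h xH xh; have [c [_ yH ->]] := partial_mvt xH xh gx.
by rewrite normrM ler_wpM2r ?gM.
Qed.

(** Two applications of the mean value theorem give the remainder without the factor 1/2; only its
    quadratic order matters. *)
Lemma partial_taylor i (g : V -> R) M : (forall y, H y -> partial_exists i g y) ->
  (forall y, H y -> partial_exists i (partial i g) y) ->
  (forall y, H y -> `|partial i (partial i g) y| <= M) -> forall x (h : R), H x ->
  H (x + h *: e_ i) ->
  `|g (x + h *: e_ i) - g x - partial i g x * h| <= M * `|h| * `|h|.
Proof.
move=> gx ggx gM x h xH xh; have [c [ch yH ->]] := partial_mvt xH xh gx.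
have M0 : 0 <= M := le_trans (normr_ge0 _) (gM _ xH).
rewrite -mulrBl normrM ler_wpM2r //.
by rewrite (le_trans (partial_lip ggx gM xH yH)) // ler_wpM2l.
Qed.

Lemma derive1_mvt (f : R -> R) a b : a <= b ->
  (forall t, a <= t <= b -> derivable f t 1) ->
  exists2 c, a <= c <= b & f b - f a = derive1 f c * (b - a).
Proof.
move=> ab fd.
have [||c] := @MVT_segment R f (derive1 f) a b ab; last by rewrite in_itv; exists c.
- move=> t; rewrite in_itv /= => /andP[at_ tb].
  by rewrite derive1E; apply/derivableP/fd; rewrite !ltW.
- by apply: derivable_within_continuous => t; rewrite in_itv => /fd.
Qed.

Lemma derive1_mvt_sym (f : R -> R) a b t h :
  (forall t, a <= t <= b -> derivable f t 1) -> a <= t <= b -> a <= t + h <= b ->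
  exists c, [/\ a <= c <= b, `|c - t| <= `|h| &
    f (t + h) - f t = derive1 f c * h].
Proof.
move=> fd /andP[at_ tb] /andP[ah hb]; have [h0|h0] := leP 0 h.
  have [||c /andP[tc ch] ->] := @derive1_mvt f t (t + h); first lra.
    by move=> s /andP[ts sh]; apply: fd; apply/andP; split; lra.
  exists c; split; [by apply/andP; split; lra| |by congr (_ * _); ring].
  by rewrite !ger0_norm; lra.
have [||c /andP[tc ch] E] := @derive1_mvt f (t + h) t; first lra.
  by move=> s /andP[ts sh]; apply: fd; apply/andP; split; lra.
exists c; split; [by apply/andP; split; lra| |].
  by rewrite !ler0_norm; lra.
by rewrite -opprB E -mulrN; congr (_ * _); ring.
Qed.

Lemma derive1_lip (f : R -> R) a b M :
  (forall t, a <= t <= b -> derivable f t 1) ->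
  (forall t, a <= t <= b -> `|derive1 f t| <= M) ->
  forall t h, a <= t <= b -> a <= t + h <= b -> `|f (t + h) - f t| <= M * `|h|.
Proof.
move=> fd fM t h tab hab; have [c [cab _ ->]] := derive1_mvt_sym fd tab hab.
by rewrite normrM ler_wpM2r ?fM.
Qed.

Lemma derive1_taylor (f : R -> R) a b M :
  (forall t, a <= t <= b -> derivable f t 1) ->
  (forall t, a <= t <= b -> derivable (derive1 f) t 1) ->
  (forall t, a <= t <= b -> `|derive1 (derive1 f) t| <= M) ->
  forall t h, a <= t <= b -> a <= t + h <= b ->
  `|f (t + h) - f t - derive1 f t * h| <= M * `|h| * `|h|.
Proof.
move=> fd fdd fM t h tab hab; have [c [cab ch ->]] := derive1_mvt_sym fd tab hab.
have M0 : 0 <= M := le_trans (normr_ge0 _) (fM _ tab).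
rewrite -mulrBl normrM ler_wpM2r //.
have := @derive1_lip _ _ _ _ fdd fM t (c - t) tab.
rewrite addrC subrK => /(_ cab) /le_trans; apply.
by rewrite ler_wpM2l.
Qed.

End Calculus.

(** * Functions smooth up to the boundary and the order of their derivatives *)

Section SmoothFunctions.
Variables (R : realType) (n : nat).
Notation V := 'cV[R]_n.+1.
Notation ST := (V * R)%type.
Notation H := (@closed_half_space R n).
Notation Q := (@Q_open R n).
Notation e_ i := (basis_vec R i).

Lemma coord_le_norm (x : V) i : `|x i 0| <= `|x|.
Proof.
rewrite [leRHS]/Num.norm /= mx_normrE.
exact: (le_bigmax _ (fun ij : 'I_n.+1 * 'I_1 => `|x ij.1 ij.2|) (i, 0)).
Qed.

Lemma norm_le_coord (x : V) a : 0 <= a -> (forall i, `|x i 0| <= a) -> `|x| <= a.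
Proof.
move=> a0 xa; rewrite [leLHS]/Num.norm /= mx_normrE; apply: bigmax_le => // -[i j] _ /=.
by rewrite ord1.
Qed.

Lemma norm_basis_vec (i : 'I_n.+1) : `|e_ i| <= 1.
Proof.
by apply: norm_le_coord => // j; rewrite mxE; case: (_ && _); rewrite ?normr0 ?normr1.
Qed.

Lemma within_continuousP (A : set ST) (G : ST -> R) :
  {within A, continuous G} <->
  forall z, A z -> forall e, 0 < e -> exists2 d, 0 < d & forall z', A z' ->
    `|z'.1 - z.1| < d -> `|z'.2 - z.2| < d -> `|G z' - G z| < e.
Proof.
split.
  move=> /subspace_continuousP AG z Az e e0.
  have /cvgrPdist_lt /(_ e e0) W := AG z Az.
  have [d /= d0 dG] := (nbhs_ballP z _).1 W.
  exists d => // z' Az' h1 h2; rewrite distrC; apply: dG => //.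
  by split; rewrite -ball_normE /ball_ /= distrC.
move=> AG; apply/subspace_continuousP => z Az; apply/cvgrPdist_lt => e e0.
have [d d0 dG] := AG z Az e e0.
apply/nbhs_ballP; exists d => // z' [h1 h2] Az'; rewrite distrC; apply: dG => //.
  by move: h1; rewrite -ball_normE /ball_ /= distrC.
by move: h2; rewrite -ball_normE /ball_ /= distrC.
Qed.

Lemma half_space_lip (g : V -> R) (M : 'I_n.+1 -> R) :
  (forall i y, H y -> partial_exists i g y) ->
  (forall i y, H y -> `|partial i g y| <= M i) ->
  forall x y, H x -> H y -> `|g x - g y| <= (\sum_i M i) * `|x - y|.
Proof.
move=> gx gM x y xH yH.
(* A path from y to x changing one coordinate at a time. Its last coordinate is always that of x or
   of y, so it stays in the half-space. *)
pose z (k : nat) : V := \col_j (if (j < k)%N then x j 0 else y j 0).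
have zH k : H (z k).
  by rewrite /closed_half_space /= mxE; case: ifP.
have zS (k : 'I_n.+1) : z k.+1 = z k + (x k 0 - y k 0) *: e_ k.
  apply/colP => j; rewrite !mxE ltnS leq_eqVlt eqxx andbT.
  have [->|jk] := eqVneq j k; first by rewrite eqxx ltnn mulr1 addrC subrK.
  by rewrite mulr0 addr0 (negbTE (_ : (j : nat) != k)).
have z0 : z 0%N = y by apply/colP => j; rewrite mxE.
have zn : z n.+1 = x by apply/colP => j; rewrite mxE ltn_ord.
rewrite -{1}zn -{1}z0 -(telescope_sumr (fun k => g (z k)) (leq0n n.+1)) big_mkord.
rewrite (le_trans (ler_norm_sum _ _ _)) // mulr_suml ler_sum // => k _.
have := @partial_lip R n k g (M k) (gx k) (gM k) (z k) (x k 0 - y k 0) (zH k).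
rewrite -zS => /(_ (zH k.+1)) /le_trans; apply.
have M0 : 0 <= M k := le_trans (normr_ge0 _) (gM k _ xH).
rewrite ler_wpM2l //; have := coord_le_norm (x - y) k.
by rewrite !mxE.
Qed.

Lemma Q_openP x t : Q (x, t) <-> H x /\ 0 < t.
Proof. by split; rewrite /Q_open /=; move=> [a b]; split=> //; move: b => /=; rewrite in_itv /= andbT. Qed.

Lemma near0_norm_lt (d : R) : 0 < d -> \forall h \near (0 : R), `|h| < d.
Proof. by move=> d0; exact: (@nbhs0_lt R R d d0). Qed.

(* Peano's form of Schwarz's theorem: the second difference of f over a rectangle
   with sides k and h is h * k * Dx i g at an intermediate point. *)
Lemma schwarz i (f g : ST -> R) :
  (forall z, Q z -> partial_exists i (fun y => f (y, z.2)) z.1) ->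
  (forall z, Q z -> derivable (fun s : R => f (z.1, s)) z.2 1 /\ Dt f z = g z) ->
  (forall z, Q z -> partial_exists i (fun y => g (y, z.2)) z.1) ->
  {within Q, continuous (Dx i g)} ->
  forall z, Q z -> derivable (fun s : R => Dx i f (z.1, s)) z.2 1 /\
    Dt (Dx i f) z = Dx i g z.
Proof.
move=> fx ft gx /within_continuousP gc [x t] /[dup] Qz /Q_openP[xH t0] /=.
apply: derive1_crit => e e0; have [d d0 dg] := gc _ Qz e e0.
have FF := @increments_proper R n i x xH.
near=> h.
have hd : `|h| < d by near: h; exact: near0_norm_lt.
have ht : `|h| < t by near: h; exact: near0_norm_lt.
have th0 : 0 < t + h by move: ht; rewrite ltr_norml => /andP[]; lra.
pose q k := diff_quotient i (fun y => f (y, t + h)) x k -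
            diff_quotient i (fun y => f (y, t)) x k.
(* With h fixed, k tends to 0 and q k tends to the time increment of [Dx i f]; a closed bound valid
   for all small k passes to this limit. *)
apply: (@cvg_dist_le R _ (increments i x) q) => //.
  apply: cvgB; apply: partial_cvg.
    by apply: (fx (x, t + h)); apply/Q_openP.
  by apply: (fx (x, t)); apply/Q_openP.
apply/increments_ball; exists d => // k kd k0 xk.
have dpsi s : t - `|h| <= s <= t + `|h| -> 0 < s.
  by move=> /andP[]; move: ht; lra.
have fxs y s : H y -> 0 < s ->
    derivable (fun s : R => f (y, s)) s 1 /\ Dt f (y, s) = g (y, s).
  by move=> yH s0; apply: (ft (y, s)); apply/Q_openP.
have [|||c [cab ch E]] := @derive1_mvt_sym R
    (fun s => f (x + k *: e_ i, s) - f (x, s)) (t - `|h|) (t + `|h|) t h.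
- move=> s /dpsi s0; have [? _] := fxs _ _ xk s0; have [? _] := fxs _ _ xH s0.
  exact: derivableB.
- by have := normr_ge0 h; move=> h0; apply/andP; split; lra.
- by have := ler_norm h; have := ler_norm (- h); rewrite normrN => ? ?; apply/andP; split; lra.
have c0 := dpsi _ cab.
have Ed : derive1 (fun s => f (x + k *: e_ i, s) - f (x, s)) c =
    g (x + k *: e_ i, c) - g (x, c).
  have [h1 E1] := fxs _ _ xk c0; have [h2 E2] := fxs _ _ xH c0.
  rewrite -E1 -E2 /Dt /= !derive1E; exact: deriveB.
have [|c' [ck yH Ec]] := @partial_mvt R n i (fun y => g (y, c)) x k xH xk.
- by move=> y yH; apply: (gx (y, c)); apply/Q_openP.
rewrite Ed Ec in E.
have -> : q k - Dx i g (x, t) * h = (Dx i g (x + c' *: e_ i, c) - Dx i g (x, t)) * h.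
  rewrite /q /diff_quotient -mulrBr.
  set A := f _; rewrite (_ : f (x + k *: e_ i, t + h) - f (x, t + h) -
    (f (x + k *: e_ i, t) - f (x, t)) = Dx i g (x + c' *: e_ i, c) * k * h) //.
  by field.
rewrite normrM ler_wpM2r // ltW //; apply: dg => /=.
- by apply/Q_openP.
- rewrite addrC addKr normrZ (le_lt_trans _ kd) // (le_trans _ ck) //.
  by rewrite ler_piMr // norm_basis_vec.
- exact: le_lt_trans hd.
Unshelve. all: by end_near.
Qed.

Definition smooth (f : ST -> R) := has_cont_derivs (fun _ _ => true) Q f.

Lemma smooth_partial_exists f i s m z : smooth f -> Q z ->
  partial_exists i (fun y => partials s m f (y, z.2)) z.1.
Proof. by move=> /(_ (i :: s) m isT)[+ _]; apply. Qed.

Lemma Dt_ext (f g : ST -> R) z : (forall z, Q z -> f z = g z) -> Q z ->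
  (derivable (fun s : R => f (z.1, s)) z.2 1 ->
   derivable (fun s : R => g (z.1, s)) z.2 1) /\ Dt f z = Dt g z.
Proof.
case: z => x t fg /Q_openP[xH t0] /=.
have near_eq : \forall h \near (0 : R),
    (f (x, h + t) = g (x, h + t)) /\ (f (x, t) = g (x, t)).
  near=> h; have ht : `|h| < t by near: h; exact: near0_norm_lt.
  by split; apply: fg; apply/Q_openP; split => //; move: ht; rewrite ltr_norml; lra.
split; last first.
  rewrite /Dt /derive1; congr (lim _); apply/seteqP; split=> A; rewrite /fmap /=;
  rewrite /dnbhs /within /=; apply: filterS2 near_eq => h [E1 E2] hA h0;
  by move: (hA h0); rewrite /preimage /= E1 E2.
rewrite /derivable => /cvg_ex[l fl]; apply/cvg_ex; exists l; move: fl.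
apply: cvg_trans => A; rewrite /fmap /= /dnbhs /within /=.
apply: filterS2 near_eq => h [E1 E2] hA h0.
by move: (hA h0); rewrite /preimage /= [h *: 1]mulr1 E1 E2.
Unshelve. all: by end_near.
Qed.

Lemma Dx_ext_Q i (f g : ST -> R) z : (forall z, Q z -> f z = g z) -> Q z ->
  (partial_exists i (fun y => f (y, z.2)) z.1 ->
   partial_exists i (fun y => g (y, z.2)) z.1) /\ Dx i f z = Dx i g z.
Proof.
case: z => x t fg /Q_openP[xH t0]; apply: partial_ext => // y; rewrite inE => yH.
by apply: fg; apply/Q_openP.
Qed.

Lemma within_continuous_ext (A : set ST) (f g : ST -> R) :
  (forall z, A z -> f z = g z) ->
  {within A, continuous f} -> {within A, continuous g}.
Proof.
move=> fg /within_continuousP fc; apply/within_continuousP => z Az e e0.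
have [d d0 df] := fc z Az e e0; exists d => // z' Az' h1 h2.
by rewrite -!fg //; exact: df.
Qed.

(** Smoothness only speaks of time derivatives taken innermost. Induction on s with Schwarz's
    theorem carries one more [Dt] in from the outside, past one space derivative at a time. *)
Lemma Dt_partials f : smooth f -> forall s m z, Q z ->
  derivable (fun t : R => partials s m f (z.1, t)) z.2 1 /\
  Dt (partials s m f) z = partials s m.+1 f z.
Proof.
move=> fs; elim=> [|i s IH] m z Qz.
  by split => //; apply: (proj1 (fs [::] m.+1 isT)).
apply: (@schwarz i (partials s m f) (partials s m.+1 f)) => //.
- by move=> ? ?; exact: smooth_partial_exists.
- by move=> ? ?; exact: IH.
- by move=> ? ?; exact: smooth_partial_exists.
- exact: (proj2 (fs (i :: s) m.+1 isT)).
Qed.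

(** Only [Dx i] and [Dt] are exchanged: i ends up innermost among the space derivatives, hence
    [rcons], and these are never permuted among themselves. *)
Lemma partials_Dx f i : smooth f -> forall s m z, Q z ->
  partials s m (Dx i f) z = partials (rcons s i) m f z.
Proof.
move=> fs; elim=> [|j s IH] m z Qz; last first.
  by apply: (proj2 (Dx_ext_Q _ _ Qz)) => z' Qz'; exact: IH.
elim: m z Qz => // m IH z Qz.
rewrite /= /partials /= -/(partials [::] m (Dx i f)).
rewrite (proj2 (Dt_ext IH Qz)); exact: (proj2 (Dt_partials fs [:: i] m Qz)).
Qed.

Lemma smooth_Dx f i : smooth f -> smooth (Dx i f).
Proof.
move=> fs s m _; split; last first.
  apply: (@within_continuous_ext _ (partials (rcons s i) m f)).
    by move=> z Qz; rewrite partials_Dx.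
  exact: (proj2 (fs (rcons s i) m isT)).
have E s' m' z : Q z -> partials (rcons s' i) m' f z = partials s' m' (Dx i f) z.
  by move=> Qz; rewrite partials_Dx.
case: s m => [|j s] [|m] //= z Qz.
- apply: (proj1 (Dt_ext (E [::] m) Qz)).
  exact: (proj1 (Dt_partials fs _ _ Qz)).
- apply: (proj1 (Dx_ext_Q j (E s 0%N) Qz)); exact: smooth_partial_exists.
- apply: (proj1 (Dx_ext_Q j (E s m.+1) Qz)); exact: smooth_partial_exists.
Qed.

End SmoothFunctions.

(** * Limits of smooth families along ultrafilters *)

Section Families.
Variables (R : realType) (n : nat).
Notation V := 'cV[R]_n.+1.
Notation ST := (V * R)%type.
Notation H := (@closed_half_space R n).
Notation Q := (@Q_open R n).
Notation e_ i := (basis_vec R i).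

(** Compactness of the interval from -M to M gives a cluster point. For an ultrafilter it is a
    limit: if the preimage of a neighbourhood were not in U, its complement would be, which
    clustering forbids. *)
Lemma ultra_bounded_cvg (T : Type) (U : set_system T) (f : T -> R) (M : R) : UltraFilter U ->
  (forall s, `|f s| <= M) -> exists l : R, f @ U --> l.
Proof.
move=> UU fM; have UP : ProperFilter U by exact: ultra_proper.
have := @segment_compact R (- M) M.
move=> /(_ (f @ U) _) [].
  by apply: (@filterE _ U) => s /=; rewrite in_itv /= -ler_norml.
move=> l [_ fl]; exists l => A Al.
have [//|UA] := in_ultra_setVsetC (f @^-1` A) UU.
by have [y [/= ny Ay]] := fl (~` A) A UA Al.
Qed.

(** If the preimage of some neighbourhood A of l is not in G, then G restricted to the complement of
    that preimage is still proper, and an ultrafilter above the restriction contradicts the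
    assumption. *)
Lemma ultra_cvg (T : Type) (G : set_system T) (f : T -> R) (l : R) : ProperFilter G ->
  (forall U, UltraFilter U -> G `<=` U -> f @ U --> l) -> f @ G --> l.
Proof.
move=> GG fU A Al; apply: contrapT => nGA.
pose B := ~` (f @^-1` A).
have BP : ProperFilter (within B G).
  apply: Build_ProperFilter_ex => C; rewrite /within /= => GC.
  apply: contrapT => nC; apply: nGA; rewrite /fmap /=.
  apply: filterS GC => x BC; apply: contrapT => nA; apply: nC; exists x; exact: BC.
have [U [UU BU]] := ultraFilterLemma BP.
have UP : ProperFilter U by exact: ultra_proper.
have UA : U (f @^-1` A).
  apply: (fU U UU _ _ Al); apply: (subset_trans _ BU) => C GC.
  by rewrite /within /=; apply: filterS GC.
have UB : U B by apply: BU; rewrite /within /=; exact: filterE.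
by have [x [/= h1 h2]] := filter_ex (filterI UA UB); apply: h2.
Qed.

Definition equicontinuous_on (A : set ST) (F : R -> ST -> R) :=
  forall z, A z -> forall e, 0 < e -> exists2 d, 0 < d & forall s z', A z' ->
    `|z'.1 - z.1| < d -> `|z'.2 - z.2| < d -> `|F s z' - F s z| <= e.

Lemma equicontinuous_limit A F w (U : set_system R) : ProperFilter U ->
  equicontinuous_on A F -> (forall z, A z -> F s z @[s --> U] --> w z) ->
  {within A, continuous w}.
Proof.
move=> UP AF Fw; apply/within_continuousP => z Az e e0.
have e2 : 0 < e / 2 by rewrite divr_gt0.
have [d d0 dF] := AF z Az (e / 2) e2.
exists d => // z' Az' h1 h2.
apply: (@le_lt_trans _ _ (e / 2)); last by rewrite ltr_pdivrMr // mulr_natr mulr2n ltrDl.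
rewrite -[X in `|X|]subr0; apply: (@cvg_dist_le R _ U (fun s => F s z' - F s z)).
  by apply: cvgB; exact: Fw.
by apply: filterE => s; rewrite subr0; exact: dF.
Qed.

(** Compactness is used in filter form. Were the convergence not uniform, the sets that eventually
    contain all bad points would form a proper filter on K, and this filter would cluster at some z
    of K. *)
Lemma equicontinuous_uniform A F w (U : set_system R) K : ProperFilter U ->
  equicontinuous_on A F -> (forall z, A z -> F s z @[s --> U] --> w z) ->
  compact K -> K `<=` A -> forall e, 0 < e ->
  \forall s \near U, forall z, K z -> `|F s z - w z| <= e.
Proof.
move=> UP AF Fw Kc KA e e0.
have wc := equicontinuous_limit UP AF Fw.
have e4 : 0 < e / 4 by rewrite divr_gt0.
apply: contrapT => nU.
pose B (s : R) : set ST := [set z | K z /\ ~ (`|F s z - w z| <= e)].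
pose G (D : set ST) := \forall s \near U, B s `<=` D.
have GP : ProperFilter G.
  split; first by rewrite /G => h; apply: nU; apply: filterS h => s Bs z Kz;
    apply: contrapT => nz; exact: (Bs z (conj Kz nz)).
  apply: Build_Filter; first by apply: (@filterE _ U).
    move=> C D h1 h2; exact: (@filterS2 _ U _ _ _ _
    (fun s a b z Bz => conj (a z Bz) (b z Bz)) h1 h2).
  by move=> C D CD; apply: (@filterS _ U) => s a z /a /CD.
have GK : G K by apply: (@filterE _ U) => s z [].
have [z [Kz Gz]] := Kc G GP GK.
have Az := KA z Kz.
have [d d0 dF] := AF z Az (e / 4) e4.
have [d' d'0 dw] := (within_continuousP _ _).1 wc z Az (e / 4) e4.
have FwU : \forall s \near U, `|w z - F s z| < e / 4 by exact: (cvgrPdist_lt _ _).1 (Fw z Az) _ e4.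
(* Equicontinuity of F, convergence at z and continuity of w cost e / 4 each, so eventually all bad
   points keep a fixed distance from z, against clustering. *)
have GN : G [set z' | K z' /\ Num.min d d' <= Num.max `|z'.1 - z.1| `|z'.2 - z.2|].
  apply: (@filterS _ U _ _ _ _ FwU) => s Fs z' [Kz' nz']; split => //.
  rewrite leNgt; apply/negP; rewrite gt_max !lt_min => /andP[/andP[h1 h1'] /andP[h2 h2']].
  apply: nz'; have Az' := KA z' Kz'.
  have a1 := dF s z' Az' h1 h2; have a2 := dw z' Az' h1' h2'.
  rewrite (_ : F s z' - w z' = (F s z' - F s z) + ((F s z - w z) + (w z - w z'))); last by ring.
  rewrite (le_trans (ler_normD _ _)) //.
  apply: (le_trans (lerD a1 (ler_normD _ _))).
  move: Fs a2; rewrite distrC (distrC (w z')) => ? ?; lra.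
have NB : nbhs z (ball z (Num.min d d')).
  by apply: nbhsx_ballx; rewrite lt_min d0.
have [z' [[Kz' h] [h1 h2]]] := Gz _ _ GN NB.
move: h; rewrite leNgt gt_max => /negP; apply.
move: h1 h2; rewrite -!ball_normE /ball_ /= => h1 h2.
by rewrite distrC h1 distrC h2.
Qed.

(** Order 0 is left out of the bounds because the rescaled solutions may grow linearly in x; all
    other derivatives are bounded on the whole half-space, away from t = 0. *)
Definition smooth_family (F : R -> ST -> R) :=
  (forall s, smooth (F s)) /\
  forall l m, (0 < size l + m)%N -> forall a b, 0 < a -> exists M, forall s x t,
    H x -> a <= t <= b -> `|partials l m (F s) (x, t)| <= M.

(** The move from x to y at time t and the move from t to t' at y use only derivatives of one order
    more, so the case of order 0 is covered as well. *)
Lemma smooth_family_lip F l m : smooth_family F -> forall a b, 0 < a ->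
  exists M, forall s x y t t', H x -> H y -> a <= t <= b -> a <= t' <= b ->
  `|partials l m (F s) (x, t) - partials l m (F s) (y, t')| <=
     M * (`|x - y| + `|t - t'|).
Proof.
move=> [Fs Fb] a b a0.
have /choice[M MF] i := Fb (i :: l) m isT a b a0.
have [|N NF] := Fb l m.+1 _ a b a0; first by rewrite addnS.
exists (\sum_i `|M i| + `|N|) => s x y t t' xH yH tab tab'.
have t0 u : a <= u <= b -> 0 < u by move=> /andP[+ _]; exact: lt_le_trans.
have h1 : `|partials l m (F s) (x, t) - partials l m (F s) (y, t)| <=
    (\sum_i `|M i|) * `|x - y|.
  apply: (@half_space_lip R n (fun y => partials l m (F s) (y, t))) => //.
    move=> i z zH; apply: (@smooth_partial_exists R n (F s) i l m (z, t)) => //.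
    by apply/Q_openP; split => //; exact: t0 tab.
  by move=> i z zH; rewrite (le_trans (MF i s z t zH tab)) // ler_norm.
have h2 : `|partials l m (F s) (y, t) - partials l m (F s) (y, t')| <= `|N| * `|t - t'|.
  have D u : a <= u <= b -> derivable (fun t : R => partials l m (F s) (y, t)) u 1 /\
      Dt (partials l m (F s)) (y, u) = partials l m.+1 (F s) (y, u).
    move=> uab; apply: (@Dt_partials R n (F s) (Fs s) l m (y, u)).
    by apply/Q_openP; split => //; exact: t0 uab.
  have P1 u : a <= u <= b -> derivable (fun u : R => partials l m (F s) (y, u)) u 1.
    by move=> /D[].
  have P2 u : a <= u <= b ->
      `|derive1 (fun u : R => partials l m (F s) (y, u)) u| <= `|N|.
    move=> /[dup] /D[_]; rewrite /Dt /= => -> uab.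
    by rewrite (le_trans (NF s y u yH uab)) // ler_norm.
  have := @derive1_lip R _ a b `|N| P1 P2 t' (t - t') tab'.
  by rewrite addrC subrK; apply.
set A := partials _ _ _ _ in h1 *; set B := partials _ _ _ _ in h1 h2 *.
set C := partials _ _ _ _ in h2 *.
have S0 : 0 <= \sum_i `|M i| by rewrite sumr_ge0.
rewrite (_ : A - C = (A - B) + (B - C)); last by ring.
rewrite (le_trans (ler_normD _ _)) // mulrDr !mulrDl.
apply: (le_trans (lerD h1 h2)).
by rewrite lerD // ?lerDl ?lerDr ?mulr_ge0.
Qed.

Lemma smooth_family_equicontinuous F l m : smooth_family F ->
  equicontinuous_on Q (fun s => partials l m (F s)).
Proof.
move=> FF [x t] /Q_openP[xH t0] e e0.
have [|M MF] := @smooth_family_lip F l m FF (t / 2) (t + t / 2); first by rewrite divr_gt0.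
have M1 : 0 < `|M| + 1 by rewrite ltr_wpDl.
(* The radius t / 2 keeps u in the time interval for which M was chosen; the last halving shares e
   between the space and the time distance. *)
exists (Num.min (t / 2) (e / (`|M| + 1) / 2)); first by rewrite lt_min !divr_gt0.
move=> s [y u] /Q_openP[yH u0] /=; rewrite !lt_min => /andP[_ h1] /andP[h2 h3].
have := MF s y x u t yH xH; move=> /(_ _ _)/le_trans; apply.
- by move: h2; rewrite ltr_norml => /andP[? ?]; apply/andP; split; lra.
- by apply/andP; split; lra.
apply: (@le_trans _ _ ((`|M| + 1) * (e / (`|M| + 1)))); last first.
  by rewrite mulrC divfK // gt_eqF.
have z0 : 0 <= `|y - x| + `|u - t| by rewrite addr_ge0.
apply: (@le_trans _ _ ((`|M| + 1) * (`|y - x| + `|u - t|))).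
  by rewrite ler_wpM2r // (le_trans (ler_norm M)) // lerDl.
by rewrite ler_wpM2l ?(ltW M1) //; lra.
Qed.

End Families.

Section FamilyLimit.
Variables (R : realType) (n : nat).
Notation V := 'cV[R]_n.+1.
Notation ST := (V * R)%type.
Notation H := (@closed_half_space R n).
Notation Q := (@Q_open R n).
Notation e_ i := (basis_vec R i).

Lemma quadratic_small (M e h : R) : `|h| < e / (`|M| + 1) ->
  M * `|h| * `|h| <= e * `|h|.
Proof.
have M1 : 0 < `|M| + 1 by rewrite ltr_wpDl.
rewrite ltr_pdivlMr // => he; rewrite ler_wpM2r // (le_trans _ (ltW he)) // mulrC.
by rewrite ler_wpM2l // (le_trans (ler_norm M)) // lerDl.
Qed.

Variables (F : R -> ST -> R) (U : set_system R) (W : seq 'I_n.+1 -> nat -> ST -> R).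
Hypotheses (UP : ProperFilter U) (FF : smooth_family F).
Hypothesis FW : forall l m z, Q z -> partials l m (F s) z @[s --> U] --> W l m z.

Lemma taylor_limit (f g r : R -> R) (a b c h e : R) :
  f s @[s --> U] --> a -> g s @[s --> U] --> b -> r s @[s --> U] --> c ->
  (forall s, `|f s - g s - r s * h| <= e) -> `|a - b - c * h| <= e.
Proof.
move=> fa gb rc fe; rewrite -[X in `|X|]subr0.
apply: (@cvg_dist_le R _ U (fun s => f s - g s - r s * h)).
  by apply: cvgB; [exact: cvgB|apply: cvgM => //; exact: cvg_cst].
by apply: filterE => s; rewrite subr0.
Qed.

(** The second order remainder has a constant independent of s. It therefore passes to the pointwise
    limits W, and [partial_crit] reads the derivative off it; no uniform convergence enters. *)
Lemma limit_Dx i l m z : Q z ->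
  partial_exists i (fun y => W l m (y, z.2)) z.1 /\ Dx i (W l m) z = W (i :: l) m z.
Proof.
case: z => x t /Q_openP[xH t0]; apply: partial_crit => // e e0 /=.
(* Only the time t occurs in a space derivative, so the degenerate interval from t to t is
   enough. *)
have [M MF] := FF.2 (i :: i :: l) m isT t t t0.
have M1 : 0 < `|M| + 1 by rewrite ltr_wpDl.
apply/increments_ball; exists (e / (`|M| + 1)); first by rewrite divr_gt0.
move=> h he h0 xh; apply: (le_trans _ (quadratic_small he)).
have QQ y : H y -> Q (y, t) by move=> yH; apply/Q_openP.
apply: (taylor_limit (@FW l m _ (QQ _ xh)) (@FW l m _ (QQ _ xH)) (@FW (i :: l) m _ (QQ _ xH))).
move=> s; apply: (@partial_taylor R n i (fun y => partials l m (F s) (y, t)) M) => //.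
- by move=> y yH; apply: (@smooth_partial_exists _ _ _ i l m (y, t)); [exact: FF.1|exact: QQ].
- by move=> y yH; apply: (@smooth_partial_exists _ _ _ i (i :: l) m (y, t)); [exact: FF.1|exact: QQ].
- by move=> y yH; apply: (MF s y t yH); rewrite !lexx.
Qed.

(** The case of no space derivative suffices, because [partials] applies [Dt] before every [Dx]. *)
Lemma limit_Dt m z : Q z ->
  derivable (fun t : R => W [::] m (z.1, t)) z.2 1 /\
  Dt (W [::] m) z = W [::] m.+1 z.
Proof.
case: z => x t /Q_openP[xH t0]; apply: derive1_crit => e e0 /=.
have [||M MF] := FF.2 [::] m.+2 _ (t / 2) (t + t / 2) => //; first by rewrite divr_gt0.
have M1 : 0 < `|M| + 1 by rewrite ltr_wpDl.
near=> h.
have he : `|h| < e / (`|M| + 1) by near: h; apply: near0_norm_lt; rewrite divr_gt0.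
have ht : `|h| < t / 2 by near: h; apply: near0_norm_lt; rewrite divr_gt0.
apply: (le_trans _ (quadratic_small he)).
have QQ u : t / 2 <= u <= t + t / 2 -> Q (x, u).
  by move=> /andP[? ?]; apply/Q_openP; split => //; lra.
have tt : t / 2 <= t <= t + t / 2 by apply/andP; split; lra.
have th : t / 2 <= t + h <= t + t / 2.
  by move: ht; rewrite ltr_norml => /andP[? ?]; apply/andP; split; lra.
apply: (taylor_limit (@FW [::] m _ (QQ _ th)) (@FW [::] m _ (QQ _ tt))
  (@FW [::] m.+1 _ (QQ _ tt))).
move=> s; apply: (@derive1_taylor R (fun u => partials [::] m (F s) (x, u)) _ _ M) => //.
- by move=> u /QQ Qu; have := proj1 (FF.1 s [::] m.+1 isT) _ Qu.
- by move=> u /QQ Qu; have := proj1 (FF.1 s [::] m.+2 isT) _ Qu.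
- by move=> u uu; apply: (MF s x u xH uu).
Unshelve. all: by end_near.
Qed.

Variable w : ST -> R.
Hypothesis wW : forall z, Q z -> w z = W [::] 0%N z.

Lemma limit_partials l m z : Q z -> partials l m w z = W l m z.
Proof.
elim: l z => [|i l IH] z Qz; last first.
  by rewrite -(proj2 (limit_Dx i l m Qz)); apply: (proj2 (Dx_ext_Q i IH Qz)).
elim: m z Qz => [|m IH] z Qz; first exact: wW.
by rewrite -(proj2 (limit_Dt m Qz)); apply: (proj2 (Dt_ext IH Qz)).
Qed.

Lemma limit_smooth : smooth w.
Proof.
have E l m z : Q z -> W l m z = partials l m w z by move=> Qz; rewrite limit_partials.
move=> l m _; split; last first.
  apply: (within_continuous_ext (E l m)).
  exact: (equicontinuous_limit UP (smooth_family_equicontinuous l m FF) (@FW l m)).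
have X i l' z : Q z -> partial_exists i (fun y => partials l' m w (y, z.2)) z.1.
  move=> Qz; apply: (proj1 (Dx_ext_Q i (E l' m) Qz)); exact: (proj1 (limit_Dx i l' m Qz)).
case: l => [|i l] z Qz; last exact: (X i l z Qz).
case: m {X} => [//|m].
by apply: (proj1 (Dt_ext (E [::] m) Qz)); exact: (proj1 (limit_Dt m Qz)).
Qed.

End FamilyLimit.

(** * Passage to the limit in the equation *)

Section PartialRules.
Variables (R : realType) (n : nat).
Notation V := 'cV[R]_n.+1.
Notation H := (@closed_half_space R n).
Notation e_ i := (basis_vec R i).

Lemma increments_cvg i (g : V -> R) x : H x -> partial_exists i g x ->
  g (x + h *: e_ i) @[h --> increments i x] --> g x.
Proof.
move=> xH gx; have FF := @increments_proper R n i x xH.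
apply/cvgrPdist_lt => e e0; have [d d0 dg] := partial_continuous xH gx e0.
by apply/increments_ball; exists d => // h hd _ xh; rewrite distrC; exact: dg.
Qed.

Variables (i : 'I_n.+1) (x : V).
Hypothesis xH : H x.
Let FF := @increments_proper R n i x xH.

Lemma partial_cst (c : R) :
  partial_exists i (fun _ => c) x /\ partial i (fun _ => c) x = 0.
Proof.
apply: partial_eq => //; rewrite /diff_quotient subrr.
by rewrite (_ : (fun h => _) = fun _ => 0); [exact: cvg_cst|apply/funext => h; rewrite mulr0].
Qed.

Variables (f g : V -> R).
Hypothesis fx : partial_exists i f x.

Lemma partialD : partial_exists i g x ->
  partial_exists i (fun y => f y + g y) x /\
  partial i (fun y => f y + g y) x = partial i f x + partial i g x.
Proof.
move=> gx; apply: partial_eq => //.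
rewrite (_ : diff_quotient i (fun y => f y + g y) x =
  fun h => diff_quotient i f x h + diff_quotient i g x h).
  by apply: cvgD; exact: partial_cvg.
by apply/funext => h; rewrite /diff_quotient; ring.
Qed.

Lemma partialM : partial_exists i g x ->
  partial_exists i (fun y => f y * g y) x /\
  partial i (fun y => f y * g y) x = partial i f x * g x + f x * partial i g x.
Proof.
move=> gx; apply: partial_eq => //.
rewrite (_ : diff_quotient i (fun y => f y * g y) x =
  fun h => diff_quotient i f x h * g (x + h *: e_ i) + f x * diff_quotient i g x h).
  apply: cvgD; apply: cvgM; try exact: partial_cvg; try exact: cvg_cst.
  exact: increments_cvg.
by apply/funext => h; rewrite /diff_quotient; ring.
Qed.

Lemma partialV : (forall y, H y -> f y != 0) ->
  partial_exists i (fun y => (f y)^-1) x /\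
  partial i (fun y => (f y)^-1) x = - (partial i f x * ((f x)^-1 * (f x)^-1)).
Proof.
move=> f0; apply: partial_eq => //.
have : (- (diff_quotient i f x h * ((f (x + h *: e_ i))^-1 * (f x)^-1)))
    @[h --> increments i x] --> - (partial i f x * ((f x)^-1 * (f x)^-1)).
  apply: cvgN; apply: cvgM; first exact: partial_cvg.
  by apply: cvgM; [apply: cvgV; [exact: f0|exact: increments_cvg]|exact: cvg_cst].
apply: cvg_trans; apply: near_eq_cvg.
apply: filterS (increments_mem i x) => h [h0 xh].
by rewrite /diff_quotient; field; rewrite h0 !f0.
Qed.

(** The denominator is the limit of the conjugate factor. Left as a sum of two roots, it is built
    from sums and inverses, and the induction in [dconv_sqrt] closes. *)
Lemma partial_sqrt : (forall y, H y -> 0 < f y) ->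
  partial_exists i (fun y => Num.sqrt (f y)) x /\
  partial i (fun y => Num.sqrt (f y)) x =
    partial i f x * (Num.sqrt (f x) + Num.sqrt (f x))^-1.
Proof.
move=> f0; apply: partial_eq => //.
have s0 y : H y -> 0 < Num.sqrt (f y) by move=> yH; rewrite sqrtr_gt0 f0.
have : (diff_quotient i f x h * (Num.sqrt (f (x + h *: e_ i)) + Num.sqrt (f x))^-1)
    @[h --> increments i x] --> partial i f x * (Num.sqrt (f x) + Num.sqrt (f x))^-1.
  apply: cvgM; first exact: partial_cvg.
  apply: cvgV; first by rewrite gt_eqF // addr_gt0 // s0.
  apply: cvgD; last exact: cvg_cst.
  apply: (cvg_comp _ _ (increments_cvg xH fx)); exact: sqrt_continuous.
apply: cvg_trans; apply: near_eq_cvg.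
apply: filterS (increments_mem i x) => h [h0 xh].
rewrite /diff_quotient; have := s0 _ xh; have := s0 _ xH => a b.
have E y : H y -> f y = Num.sqrt (f y) * Num.sqrt (f y).
  by move=> yH; rewrite -expr2 sqr_sqrtr // ltW // f0.
rewrite (E _ xh) (E _ xH) -!expr2 subr_sqr sqr_sqrtr ?(ltW (f0 _ xh)) // sqr_sqrtr ?(ltW (f0 _ xH)) //.
by field; rewrite h0 gt_eqF // addr_gt0.
Qed.

End PartialRules.

(** * Convergence of curvature and flux *)

Section DerivativeConvergence.
Variables (R : realType) (n : nat).
Notation V := 'cV[R]_n.+1.
Notation ST := (V * R)%type.
Notation H := (@closed_half_space R n).
Notation Q := (@Q_open R n).
Variables (U : set_system R).
Hypothesis UP : ProperFilter U.

(* Order-k convergence is stable under Dx (losing one order) and under the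
   algebraic operations and square roots that make up curvature and flux. *)
Fixpoint dconv (k : nat) (F : R -> ST -> R) (f : ST -> R) : Prop :=
  (forall z, Q z -> F s z @[s --> U] --> f z) /\
  if k is k'.+1 then forall i,
    (forall z, Q z -> (forall s, partial_exists i (fun y => F s (y, z.2)) z.1) /\
      partial_exists i (fun y => f (y, z.2)) z.1) /\
    dconv k' (fun s => Dx i (F s)) (Dx i f)
  else True.

Lemma dconv_cvg k F f : dconv k F f -> forall z, Q z -> F s z @[s --> U] --> f z.
Proof. by case: k => [|k] []. Qed.

Lemma dconv_pred k F f : dconv k.+1 F f -> dconv k F f.
Proof.
elim: k F f => [|k IH] F f [Ff FD]; split => // i.
by have [? ?] := FD i; split => //; exact: IH.
Qed.

Lemma dconv_ext k F f G g : (forall s z, Q z -> F s z = G s z) ->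
  (forall z, Q z -> f z = g z) -> dconv k F f -> dconv k G g.
Proof.
elim: k F f G g => [|k IH] F f G g FG fg [Ff FD]; split => //.
- move=> z Qz; rewrite -fg // (_ : (fun s => G s z) = fun s => F s z).
    exact: Ff.
  by apply/funext => s; rewrite FG.
- move=> z Qz; rewrite -fg // (_ : (fun s => G s z) = fun s => F s z).
    exact: Ff.
  by apply/funext => s; rewrite FG.
- move=> i; have [FE FDi] := FD i; split; last first.
    apply: IH FDi => [s z|z] Qz; first exact: (proj2 (Dx_ext_Q i (FG s) Qz)).
    exact: (proj2 (Dx_ext_Q i fg Qz)).
  move=> z Qz; have [h1 h2] := FE z Qz; split.
    by move=> s; apply: (proj1 (Dx_ext_Q i (FG s) Qz)).
  exact: (proj1 (Dx_ext_Q i fg Qz)).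
Qed.

(** The induction step common to constants, sums, products, inverses and roots: the derivatives
    enter as the explicit formulas DF and Df, to which an induction hypothesis applies. *)
Lemma dconvS k F f (DF : 'I_n.+1 -> R -> ST -> R) (Df : 'I_n.+1 -> ST -> R) :
  (forall z, Q z -> F s z @[s --> U] --> f z) ->
  (forall i s z, Q z -> partial_exists i (fun y => F s (y, z.2)) z.1 /\
     Dx i (F s) z = DF i s z) ->
  (forall i z, Q z -> partial_exists i (fun y => f (y, z.2)) z.1 /\
     Dx i f z = Df i z) ->
  (forall i, dconv k (DF i) (Df i)) -> dconv k.+1 F f.
Proof.
move=> Ff FE fE FD; split => // i; split.
  by move=> z Qz; split; [move=> s; exact: (FE i s z Qz).1|exact: (fE i z Qz).1].
by apply: (dconv_ext _ _ (FD i)) => [s z Qz|z Qz]; rewrite ?(FE i s z Qz).2 ?(fE i z Qz).2.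
Qed.

Lemma Q_open_half_space (z : ST) : Q z -> H z.1. Proof. by case: z => x t /Q_openP[]. Qed.

Lemma Q_open_same_time (z : ST) y : Q z -> H y -> Q (y, z.2).
Proof. by case: z => x t /Q_openP[_ t0] yH; apply/Q_openP. Qed.

Lemma dconv_exists k F f i : dconv k.+1 F f -> forall z, Q z ->
  (forall s, partial_exists i (fun y => F s (y, z.2)) z.1) /\
  partial_exists i (fun y => f (y, z.2)) z.1.
Proof. by move=> [_ /(_ i)[]]. Qed.

Lemma dconv_Dx k F f i : dconv k.+1 F f -> dconv k (fun s => Dx i (F s)) (Dx i f).
Proof. by move=> [_ /(_ i)[]]. Qed.

Lemma dconv_cst k (c : R) : dconv k (fun _ _ => c) (fun _ => c).
Proof.
elim: k c => [|k IH] c; first by split => // z _; exact: cvg_cst.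
apply: (dconvS (DF := fun _ _ _ => 0) (Df := fun _ _ => 0)) => //.
- by move=> z _; exact: cvg_cst.
- by move=> i s z Qz; apply: partial_cst; exact: Q_open_half_space.
- by move=> i z Qz; apply: partial_cst; exact: Q_open_half_space.
Qed.

Lemma dconvD k F f G g : dconv k F f -> dconv k G g ->
  dconv k (fun s z => F s z + G s z) (fun z => f z + g z).
Proof.
have base k' F' f' G' g' : dconv k' F' f' -> dconv k' G' g' ->
    forall z, Q z -> (F' s z + G' s z) @[s --> U] --> f' z + g' z.
  by move=> h1 h2 z Qz; apply: cvgD; [exact: (dconv_cvg h1)|exact: (dconv_cvg h2)].
elim: k F f G g => [|k IH] F f G g FF GG; first by split => //; exact: base FF GG.
apply: (dconvS (DF := fun i s z => Dx i (F s) z + Dx i (G s) z)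
   (Df := fun i z => Dx i f z + Dx i g z)).
- exact: base FF GG.
- move=> i s z Qz; apply: (partialD (Q_open_half_space Qz)).
    exact: (dconv_exists i FF Qz).1.
  exact: (dconv_exists i GG Qz).1.
- move=> i z Qz; apply: (partialD (Q_open_half_space Qz)).
    exact: (dconv_exists i FF Qz).2.
  exact: (dconv_exists i GG Qz).2.
- by move=> i; apply: IH; exact: dconv_Dx.
Qed.

Lemma dconvM k F f G g : dconv k F f -> dconv k G g ->
  dconv k (fun s z => F s z * G s z) (fun z => f z * g z).
Proof.
have base k' F' f' G' g' : dconv k' F' f' -> dconv k' G' g' ->
    forall z, Q z -> (F' s z * G' s z) @[s --> U] --> f' z * g' z.
  by move=> h1 h2 z Qz; apply: cvgM; [exact: (dconv_cvg h1)|exact: (dconv_cvg h2)].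
elim: k F f G g => [|k IH] F f G g FF GG; first by split => //; exact: base FF GG.
apply: (dconvS (DF := fun i s z => Dx i (F s) z * G s z + F s z * Dx i (G s) z)
   (Df := fun i z => Dx i f z * g z + f z * Dx i g z)).
- exact: base FF GG.
- move=> i s [x t] Qz; apply: (partialM (Q_open_half_space Qz)).
    exact: (dconv_exists i FF Qz).1.
  exact: (dconv_exists i GG Qz).1.
- move=> i [x t] Qz; apply: (partialM (Q_open_half_space Qz)).
    exact: (dconv_exists i FF Qz).2.
  exact: (dconv_exists i GG Qz).2.
- move=> i; apply: dconvD; apply: IH; try exact: dconv_Dx; exact: dconv_pred.
Qed.

Lemma dconvN k F f : dconv k F f -> dconv k (fun s z => - F s z) (fun z => - f z).
Proof.
move=> FF; apply: (dconv_ext _ _ (dconvM (dconv_cst k (-1)) FF)).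
  by move=> s z _; rewrite mulN1r.
by move=> z _; rewrite mulN1r.
Qed.

Lemma dconvV k F f : (forall s z, Q z -> F s z != 0) -> (forall z, Q z -> f z != 0) ->
  dconv k F f -> dconv k (fun s z => (F s z)^-1) (fun z => (f z)^-1).
Proof.
move=> F0 f0.
have base k' : dconv k' F f -> forall z, Q z -> (F s z)^-1 @[s --> U] --> (f z)^-1.
  by move=> h1 z Qz; apply: cvgV; [exact: f0|exact: (dconv_cvg h1)].
elim: k => [|k IH] FF; first by split => //; exact: base FF.
apply: (dconvS (DF := fun i s z => - (Dx i (F s) z * ((F s z)^-1 * (F s z)^-1)))
   (Df := fun i z => - (Dx i f z * ((f z)^-1 * (f z)^-1)))).
- exact: base FF.
- move=> i s [x t] Qz; apply: (partialV (Q_open_half_space Qz)).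
    exact: (dconv_exists i FF Qz).1.
  by move=> y yH; apply: F0; exact: (Q_open_same_time Qz yH).
- move=> i [x t] Qz; apply: (partialV (Q_open_half_space Qz)).
    exact: (dconv_exists i FF Qz).2.
  by move=> y yH; apply: f0; exact: (Q_open_same_time Qz yH).
- move=> i; apply: dconvN; apply: dconvM; first exact: dconv_Dx.
  by apply: dconvM; apply: IH; exact: dconv_pred.
Qed.

Lemma dconv_sqrt k F f : (forall s z, Q z -> 0 < F s z) -> (forall z, Q z -> 0 < f z) ->
  dconv k F f -> dconv k (fun s z => Num.sqrt (F s z)) (fun z => Num.sqrt (f z)).
Proof.
move=> F0 f0.
have base k' : dconv k' F f -> forall z, Q z -> Num.sqrt (F s z) @[s --> U] --> Num.sqrt (f z).
  move=> h1 z Qz; apply: (cvg_comp _ _ (dconv_cvg h1 Qz)); exact: sqrt_continuous.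
elim: k => [|k IH] FF; first by split => //; exact: base FF.
apply: (dconvS (DF := fun i s z => Dx i (F s) z * (Num.sqrt (F s z) + Num.sqrt (F s z))^-1)
   (Df := fun i z => Dx i f z * (Num.sqrt (f z) + Num.sqrt (f z))^-1)).
- exact: base FF.
- move=> i s [x t] Qz; apply: (partial_sqrt (Q_open_half_space Qz)).
    exact: (dconv_exists i FF Qz).1.
  by move=> y yH; apply: F0; exact: (Q_open_same_time Qz yH).
- move=> i [x t] Qz; apply: (partial_sqrt (Q_open_half_space Qz)).
    exact: (dconv_exists i FF Qz).2.
  by move=> y yH; apply: f0; exact: (Q_open_same_time Qz yH).
- move=> i; apply: dconvM; first exact: dconv_Dx.
  have IH' := IH (dconv_pred FF).
  apply: dconvV; last exact: dconvD.
    by move=> s z Qz; rewrite gt_eqF // addr_gt0 // sqrtr_gt0 F0.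
  by move=> z Qz; rewrite gt_eqF // addr_gt0 // sqrtr_gt0 f0.
Qed.

Lemma dconv_sum k (J : Type) (r : seq J) (F : J -> R -> ST -> R) (f : J -> ST -> R) :
  (forall j, dconv k (F j) (f j)) ->
  dconv k (fun s z => \sum_(j <- r) F j s z) (fun z => \sum_(j <- r) f j z).
Proof.
move=> Ff; elim: r => [|j r IH].
  by apply: (dconv_ext _ _ (dconv_cst k 0)) => [s z|z] _; rewrite big_nil.
by apply: (dconv_ext _ _ (dconvD (Ff j) IH)) => [s z|z] _; rewrite big_cons.
Qed.

Lemma sqr_enorm (p : V) : enorm p ^+ 2 = \sum_i p i 0 * p i 0.
Proof.
rewrite /enorm sqr_sqrtr; first by apply: eq_bigr => i _; rewrite expr2.
by apply: sumr_ge0 => i _; exact: sqr_ge0.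
Qed.

Lemma area_gt0 (p : V) : 0 < area p.
Proof. by rewrite sqrtr_gt0 ltr_pwDl // exprn_ge0 // sqrtr_ge0. Qed.

(** Lets the projection [Pmx] be expressed through the inverse area, whose convergence is settled
    first. *)
Lemma sqr_area (p : V) : (area p)^-1 * (area p)^-1 = (1 + enorm p ^+ 2)^-1.
Proof. by rewrite -invfM -expr2 sqr_sqrtr // addr_ge0 // exprn_ge0 // sqrtr_ge0. Qed.

(** All orders k come at once, so the orders lost in curvature, flux and divergence need no
    bookkeeping. *)
Lemma dconv_partials F f : (forall s, smooth (F s)) -> smooth f ->
  (forall l m z, Q z -> partials l m (F s) z @[s --> U] --> partials l m f z) ->
  forall k l m, dconv k (fun s => partials l m (F s)) (partials l m f).
Proof.
move=> Fs fs Ff; elim=> [|k IH] l m; split => //; try exact: Ff.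
move=> i; split; last exact: (IH (i :: l)).
by move=> z Qz; split => [s|]; exact: smooth_partial_exists.
Qed.

Variables (F : R -> ST -> R) (f : ST -> R).
Hypotheses (Fs : forall s, smooth (F s)) (fs : smooth f).
Hypothesis Ff : forall l m z, Q z -> partials l m (F s) z @[s --> U] --> partials l m f z.

Let Fd k l m := dconv_partials Fs fs Ff k l m.

Lemma dconv_area k : dconv k (fun s z => area (grad (F s) z)) (fun z => area (grad f z)).
Proof.
have E (h : ST -> R) (z : ST) : area (grad h z) =
    Num.sqrt (1 + \sum_(i <- index_enum 'I_n.+1) Dx i h z * Dx i h z).
  by rewrite /area sqr_enorm; congr (Num.sqrt (1 + _)); apply: eq_bigr => i _; rewrite !mxE.
have p0 (h : ST -> R) z : 0 < 1 + \sum_(i <- index_enum 'I_n.+1) Dx i h z * Dx i h z.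
  by rewrite ltr_pwDl // sumr_ge0 // => i _; rewrite -expr2 sqr_ge0.
apply: (dconv_ext (fun s z _ => esym (E (F s) z)) (fun z _ => esym (E f z))).
apply: dconv_sqrt => [s z _|z _|]; try exact: p0.
apply: dconvD; first exact: dconv_cst.
by apply: dconv_sum => j; apply: dconvM; exact: (Fd k [:: j] 0).
Qed.

Lemma dconv_area_inv k :
  dconv k (fun s z => (area (grad (F s) z))^-1) (fun z => (area (grad f z))^-1).
Proof.
by apply: dconvV (dconv_area k) => [s z _|z _]; rewrite gt_eqF // area_gt0.
Qed.

Lemma dconv_Pmx k i j :
  dconv k (fun s z => Pmx (grad (F s) z) i j) (fun z => Pmx (grad f z) i j).
Proof.
have E (h : ST -> R) (z : ST) : Pmx (grad h z) i j =
    (i == j)%:R + - ((area (grad h z))^-1 * (area (grad h z))^-1 * (Dx i h z * Dx j h z)).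
  by rewrite sqr_area /Pmx !mxE big_ord1 !mxE.
apply: (dconv_ext (fun s z _ => esym (E (F s) z)) (fun z _ => esym (E f z))).
apply: dconvD; first exact: dconv_cst.
apply: dconvN; apply: dconvM; first by apply: dconvM; exact: dconv_area_inv.
by apply: dconvM; [exact: (Fd k [:: i] 0)|exact: (Fd k [:: j] 0)].
Qed.

Lemma dconv_curvature k : dconv k (fun s => curvature (F s)) (curvature f).
Proof.
have E (h : ST -> R) (z : ST) : curvature h z =
    \sum_(i <- index_enum 'I_n.+1) \sum_(j <- index_enum 'I_n.+1)
      ((area (grad h z))^-1 * Pmx (grad h z) i j) * Dx j (Dx i h) z.
  rewrite /curvature /mxtrace; apply: eq_bigr => i _; rewrite mxE.
  by apply: eq_bigr => j _; rewrite [X in X * _]mxE [X in _ * X]mxE.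
apply: (dconv_ext (fun s z _ => esym (E (F s) z)) (fun z _ => esym (E f z))).
apply: dconv_sum => i; apply: dconv_sum => j; apply: dconvM.
  by apply: dconvM; [exact: dconv_area_inv|exact: dconv_Pmx].
exact: (Fd k [:: j; i] 0).
Qed.

Lemma dconv_flux k j :
  dconv k (fun s z => flux (F s) z j 0) (fun z => flux f z j 0).
Proof.
have E (h : ST -> R) (z : ST) : flux h z j 0 = area (grad h z) *
    \sum_(i <- index_enum 'I_n.+1) Pmx (grad h z) j i * Dx i (curvature h) z.
  rewrite /flux mxE; congr (_ * _); rewrite mxE; apply: eq_bigr => i _.
  by rewrite [X in _ * X]mxE.
apply: (dconv_ext (fun s z _ => esym (E (F s) z)) (fun z _ => esym (E f z))).
apply: dconvM; first exact: dconv_area.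
apply: dconv_sum => i; apply: dconvM; first exact: dconv_Pmx.
exact: (dconv_Dx i (dconv_curvature k.+1)).
Qed.

Lemma cvg_eq0 (q : R -> R) (l : R) : q s @[s --> U] --> l -> (forall s, q s = 0) -> l = 0.
Proof.
move=> ql q0; apply/eqP; rewrite -normr_le0 -[l]subr0.
apply: (@cvg_dist_le R _ U q) => //.
by apply: filterE => s; rewrite q0 subr0 normr0.
Qed.

(** [Q_open] contains the boundary of the half-space, so the boundary conditions pass to the limit
    pointwise exactly as the equation does. *)
Lemma SD_solution_limit (gamma : R) :
  (forall s, SD_solution gamma (F s)) -> SD_solution gamma f.
Proof.
move=> FS; split.
- by move=> l m _; exact: fs.
- move=> x t xH t0; have Qz : Q (x, t) by apply/Q_openP; split => //; exact: ltW.
  apply: (@cvg_eq0 (fun s => Dt (F s) (x, t) + div (flux (F s)) (x, t))).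
    apply: cvgD; first exact: (@Ff [::] 1 _ Qz).
    rewrite /div; apply: (@dconv_cvg 0 (fun s z => \sum_i Dx i (fun w => flux (F s) w i 0) z)
      (fun z => \sum_i Dx i (fun w => flux f w i 0) z)) => //.
    by apply: dconv_sum => i; exact: (dconv_Dx i (dconv_flux 1 i)).
  by move=> s; exact: SD_equation.
- move=> x t xN t0.
  have Qz : Q (x, t) by apply/Q_openP; split => //; rewrite /closed_half_space /= xN.
  apply: (@cvg_eq0 (fun s => Dx ord_max (F s) (x, t) -
      gamma * Num.sqrt (1 + \sum_(i | i != ord_max) Dx i (F s) (x, t) ^+ 2))).
    apply: cvgB; first exact: (@Ff [:: ord_max] 0 _ Qz).
    apply: cvgM; first exact: cvg_cst.
    apply: (@cvg_comp _ _ _ (fun s => 1 + \sum_(i | i != ord_max) Dx i (F s) (x, t) ^+ 2)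
       Num.sqrt _ _ _ _ (@sqrt_continuous R _)).
    apply: cvgD; first exact: cvg_cst.
    apply: cvg_big => [|i _]; [exact: add_continuous|rewrite expr2].
    rewrite (_ : (fun s => Dx i (F s) (x, t) ^+ 2) = fun s => Dx i (F s) (x, t) * Dx i (F s) (x, t)).
      by apply: cvgM; exact: (@Ff [:: i] 0 _ Qz).
    by apply/funext => s; rewrite expr2.
  by move=> s; exact: SD_contact_angle.
- move=> x t xN t0.
  have Qz : Q (x, t) by apply/Q_openP; split => //; rewrite /closed_half_space /= xN.
  apply: (@cvg_eq0 (fun s => flux (F s) (x, t) ord_max 0)).
    exact: (dconv_cvg (dconv_flux 0 ord_max) Qz).
  by move=> s; exact: SD_no_flux.
Qed.

End DerivativeConvergence.

(** * Lower semicontinuity and scaling of the norms *)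

Section LowerSemicontinuity.
Variable R : realType.
Variable U : set_system R.
Hypothesis UP : ProperFilter U.
Local Open Scope ereal_scope.

(** States that x is at most the lower limit of X along U; real thresholds c treat finite and
    infinite x alike. *)
Definition lsc (X : R -> \bar R) (x : \bar R) :=
  forall c : R, c%:E < x -> \forall s \near U, c%:E < X s.

Lemma lsc_le X x B : lsc X x -> (forall s, X s <= B) -> x <= B.
Proof.
move=> Xx XB; have cB (c : R) : c%:E < x -> c%:E < B.
  by move=> /Xx /filter_ex[s cs]; exact: lt_le_trans cs (XB s).
case: x {Xx} cB => [r| |] cB; case: B {XB} cB => [b| |] cB //=; rewrite ?leey ?leNye //.
- rewrite lee_fin leNgt; apply/negP => br.
  have := cB ((r + b) / 2)%R; rewrite !lte_fin => /(_ _) h.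
  have : ((r + b) / 2 < b)%R by apply: h; lra.
  by lra.
- by have := cB (r - 1)%R; rewrite lte_fin gtrDl oppr_lt0 ltr01 => /(_ isT).
- by have := cB b; rewrite ltry ltxx => /(_ isT).
- by have := cB 0%R; rewrite ltry => /(_ isT).
Qed.

Lemma lsc0 : lsc (fun _ => 0) 0.
Proof. by move=> c c0; exact: filterE. Qed.

Lemma lscD X x Y y : lsc X x -> lsc Y y -> lsc (fun s => X s + Y s) (x + y).
Proof.
move=> Xx Yy c cxy.
(* If x and y are finite, the slack x + y - c is shared equally; otherwise an infinite summand
   absorbs it. *)
have [c1 [c2 [E h1 h2]]] : exists c1 c2 : R, [/\ c = (c1 + c2)%R, c1%:E < x & c2%:E < y].
  case: x {Xx} cxy => [r| |]; case: y {Yy} => [q| |] //= cxy.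
  - exists (r - (r + q - c) / 2)%R, (q - (r + q - c) / 2)%R.
    move: cxy; rewrite -EFinD !lte_fin => cxy; split; lra.
  - by exists (r - 1)%R, (c - r + 1)%R; rewrite ltry lte_fin; split => //; lra.
  - by exists (c - q + 1)%R, (q - 1)%R; rewrite ltry lte_fin; split => //; lra.
  - by exists c, 0%R; rewrite !ltry addr0.
apply: filterS2 (Xx _ h1) (Yy _ h2) => s ? ?.
by rewrite E EFinD lteD.
Qed.

Lemma lsc_sum (I : Type) (r : seq I) (P : pred I) (X : I -> R -> \bar R) (x : I -> \bar R) :
  (forall i, P i -> lsc (X i) (x i)) ->
  lsc (fun s => \sum_(i <- r | P i) X i s) (\sum_(i <- r | P i) x i).
Proof.
move=> Xx; elim: r => [|i r IH].
  rewrite big_nil (_ : (fun s => _) = fun _ => 0); first exact: lsc0.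
  by apply/funext => s; rewrite big_nil.
rewrite big_cons (_ : (fun s => _) =
  fun s => if P i then X i s + \sum_(i <- r | P i) X i s else \sum_(i <- r | P i) X i s).
  by case: ifP => // Pi; apply: lscD => //; exact: Xx.
by apply/funext => s; rewrite big_cons.
Qed.

Lemma lscZ (a : R) X x : (0 <= a)%R -> lsc X x -> lsc (fun s => a%:E * X s) (a%:E * x).
Proof.
rewrite le_eqVlt => /predU1P[<-|a0] Xx c.
  by rewrite mul0e => c0; apply: filterE => s; rewrite mul0e.
rewrite -lte_pdivrMl // -EFinM => /Xx; apply: filterS => s.
by rewrite EFinM lte_pdivrMl.
Qed.

(** An element of S0 close to its supremum is a limit of elements of the sets S s. The suprema need
    not converge, but they cannot drop below in the limit. *)
Lemma lsc_sup (S : R -> set (\bar R)) (S0 : set (\bar R)) :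
  (forall e, S0 e -> exists (q : R -> R) (l : R),
    [/\ e = l%:E, q @ U --> l & forall s, S s (q s)%:E]) ->
  lsc (fun s => ereal_sup (S s)) (ereal_sup S0).
Proof.
move=> SS c /ereal_sup_gt[e /SS[q [l [-> ql Sq]]]]; rewrite lte_fin => cl.
have lc : (0 < l - c)%R by rewrite subr_gt0.
move/cvgrPdist_lt: ql => /(_ _ lc); apply: filterS => s h.
apply: (@lt_le_trans _ _ (q s)%:E); last exact: (ereal_sup_ubound (Sq s)).
by rewrite lte_fin; have := ler_norm (l - q s)%R; lra.
Qed.

End LowerSemicontinuity.

Section PositiveMultiples.
Variable R : realType.
Local Open Scope ereal_scope.

(** A positive real factor fixes both infinities, so distributivity holds even for a sum of opposite
    ones and no finiteness has to be checked. *)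
Lemma gt0_muleDr (a : R) (y z : \bar R) : (0 < a)%R ->
  a%:E * (y + z) = a%:E * y + a%:E * z.
Proof.
move=> a0; case: y => [y| |]; case: z => [z| |] //=;
  rewrite ?gt0_muley ?gt0_muleNy ?lte_fin //.
by rewrite -EFinD -!EFinM mulrDr.
Qed.

Lemma gt0_mule_sumr (a : R) (I : Type) (r : seq I) (P : pred I) (F : I -> \bar R) :
  (0 < a)%R -> a%:E * (\sum_(i <- r | P i) F i) = \sum_(i <- r | P i) a%:E * F i.
Proof.
move=> a0; apply: (big_morph (fun y => a%:E * y)); last by rewrite mule0.
by move=> y z; exact: gt0_muleDr.
Qed.

Lemma ereal_sup_le_scale (a : R) (S S' : set (\bar R)) : (0 < a)%R ->
  (forall e, S e -> exists2 e', S' e' & e = a%:E * e') ->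
  ereal_sup S <= a%:E * ereal_sup S'.
Proof.
move=> a0 SS; apply: ge_ereal_sup => e /SS[e' Se' ->].
by rewrite lee_wpmul2l ?lee_fin ?(ltW a0) // ereal_sup_ubound.
Qed.

End PositiveMultiples.

Section NormLimits.
Variables (R : realType) (n : nat).
Notation V := 'cV[R]_n.+1.
Notation ST := (V * R)%type.
Notation H := (@closed_half_space R n).
Notation Q := (@Q_open R n).

Lemma fnorm_cvg (U : set_system R) (I : finType) (T : R -> {ffun I -> R}) (T0 : {ffun I -> R}) :
  ProperFilter U ->
  (forall i, T s i @[s --> U] --> T0 i) -> fnorm (T s) @[s --> U] --> fnorm T0.
Proof.
move=> UP TT; rewrite /fnorm.
apply: (@cvg_comp _ _ _ (fun s => \sum_i T s i ^+ 2) Num.sqrt _ _ _ _ (@sqrt_continuous R _)).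
apply: cvg_big => [|i _]; first exact: add_continuous.
rewrite expr2 (_ : (fun s => T s i ^+ 2) = fun s => T s i * T s i); first exact: cvgM.
by apply/funext => s; rewrite expr2.
Qed.

Lemma ffun_subE (I : finType) (T T' : {ffun I -> R}) p : (T - T') p = T p - T' p.
Proof. by rewrite !ffunE. Qed.

Lemma fnormZ (I : finType) (a : R) (T T' : {ffun I -> R}) : 0 <= a ->
  (forall i, T i = a * T' i) -> fnorm T = a * fnorm T'.
Proof.
move=> a0 TT; rewrite /fnorm -[in RHS](ger0_norm a0) -sqrtr_sqr -sqrtrM ?sqr_ge0 //.
by congr Num.sqrt; rewrite mulr_sumr; apply: eq_bigr => i _; rewrite TT exprMn.
Qed.

Lemma enormZ (a : R) (x : V) : 0 <= a -> enorm (a *: x) = a * enorm x.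
Proof.
move=> a0; rewrite /enorm -[in RHS](ger0_norm a0) -sqrtr_sqr -sqrtrM ?sqr_ge0 //.
by congr Num.sqrt; rewrite mulr_sumr; apply: eq_bigr => i _; rewrite mxE exprMn.
Qed.

Lemma slab_Q a b (z : ST) : 0 <= a -> slab a b z -> Q z.
Proof.
by case: z => x t a0 [/= xH]; rewrite in_itv /= => /andP[ta _]; apply/Q_openP;
  split => //; exact: le_lt_trans ta.
Qed.

(** Pointwise convergence of the derivatives suffices: the norm is a nonnegative combination of
    suprema, each over expressions in at most two point values. *)
Lemma BC_norm_lsc (U : set_system R) k (mu a b : R) (G : R -> ST -> V) (g : ST -> V) :
  ProperFilter U -> 0 <= a ->
  (forall l m i z, Q z -> partials l m (fun w => G s w i 0) z @[s --> U] -->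
     partials l m (fun w => g w i 0) z) ->
  lsc U (fun s => BC_norm k mu a b (G s)) (BC_norm k mu a b g).
Proof.
move=> UP a0 Gg.
have Nc l m z : Q z -> forall p, nabla_vec l m (G s) z p @[s --> U] --> nabla_vec l m g z p.
  move=> Qz p; rewrite ffunE (_ : (fun s => nabla_vec l m (G s) z p) =
    fun s => partials p.2 m (fun w => G s w p.1 0) z); first exact: Gg.
  by apply/funext => s; rewrite ffunE.
have Dc l m z z' : Q z -> Q z' -> fnorm (nabla_vec l m (G s) z - nabla_vec l m (G s) z')
    @[s --> U] --> fnorm (nabla_vec l m g z - nabla_vec l m g z').
  move=> Qz Qz'; apply: fnorm_cvg => p; rewrite ffun_subE.
  rewrite (_ : (fun s => (nabla_vec l m (G s) z - nabla_vec l m (G s) z') p) =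
    fun s => nabla_vec l m (G s) z p - nabla_vec l m (G s) z' p).
    by apply: cvgB; exact: Nc.
  by apply/funext => s; rewrite ffun_subE.
apply: lscD.
  apply: lsc_sum => l _; apply: lsc_sum => m _; apply: lscZ; first exact: powR_ge0.
  apply: lsc_sup => e [z sz <-].
  exists (fun s => fnorm (nabla_vec l m (G s) z)), (fnorm (nabla_vec l m g z)).
  split=> // [|s]; last by exists z.
  by apply: fnorm_cvg; apply: Nc; exact: slab_Q sz.
apply: lscZ; first exact: powR_ge0.
apply: lscD; apply: lsc_sum => l _; apply: lsc_sum => m _; apply: lsc_sup => e.
  move=> [x [y [t [sx sy xy ->]]]].
  eexists (fun s => fnorm (nabla_vec l m (G s) (x, t) - nabla_vec l m (G s) (y, t)) / _), _.
  split; [by []| |by move=> s; exists x, y, t].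
  by apply: cvgM; [apply: Dc; [exact: slab_Q sx|exact: slab_Q sy]|exact: cvg_cst].
move=> [x [s1 [s2 [sx sy xy ->]]]].
eexists (fun s => fnorm (nabla_vec l m (G s) (x, s1) - nabla_vec l m (G s) (x, s2)) / _), _.
split; [by []| |by move=> s; exists x, s1, s2].
by apply: cvgM; [apply: Dc; [exact: slab_Q sx|exact: slab_Q sy]|exact: cvg_cst].
Qed.

End NormLimits.

(** * Behaviour of the parabolic Hölder norms under dilation *)

Section NormScaling.
Variables (R : realType) (n : nat).
Notation V := 'cV[R]_n.+1.
Notation ST := (V * R)%type.
Notation H := (@closed_half_space R n).
Notation Q := (@Q_open R n).

Lemma scale_quotient (W F E p : R) : p != 0 ->
  W * F / E = W * p * (F / (p * E)).
Proof.
move=> p0; rewrite invfM; have -> : W * p * (F * (p^-1 * E^-1)) = (p * p^-1) * (W * F / E).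
  by ring.
by rewrite divff // mul1r.
Qed.

(** A constant cancels in every difference quotient, so the identity holds with no
    differentiability; the constant survives only at order 0. *)
Lemma partials_subc l m (f : ST -> R) (c : R) :
  partials l m (fun z => f z - c) =
  fun z => partials l m f z - (if (size l + m)%N is 0%N then c else 0).
Proof.
have X i (g : ST -> R) c' : Dx i (fun z => g z - c') = fun z => Dx i g z - 0.
  apply/funext => z; rewrite subr0 /Dx /partial.
  rewrite (_ : diff_quotient i (fun y => g (y, z.2) - c') z.1 =
    diff_quotient i (fun y => g (y, z.2)) z.1) //.
  by apply/funext => h; rewrite /diff_quotient opprB addrA subrK.
have T (g : ST -> R) c' : Dt (fun z => g z - c') = fun z => Dt g z - 0.
  apply/funext => z; rewrite subr0 /Dt /derive1.
  rewrite (_ : (fun h : R => _) = fun h : R => h^-1 *: (g (z.1, h + z.2) - g (z.1, z.2))) //.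
  by apply/funext => h; rewrite opprB addrA subrK.
elim: l => [|i l IH]; last first.
  change (Dx i (partials l m (fun z => f z - c)) =
    fun z => Dx i (partials l m f) z - 0).
  by rewrite IH X.
elim: m => [//|m IH].
change (Dt (partials [::] m (fun z => f z - c)) =
  fun z => Dt (partials [::] m f) z - 0).
by rewrite IH T.
Qed.

Lemma partials_ext l m (f g : ST -> R) : (forall z, H z.1 -> f z = g z) ->
  forall z, H z.1 -> partials l m f z = partials l m g z.
Proof.
move=> fg; elim: l => [|i l IH] z zH; last by apply: Dx_ext => // y yH; exact: IH.
elim: m z zH => [|m IH] z zH; first exact: fg.
rewrite /partials /= /Dt; congr (derive1 _ _); apply/funext => s; exact: (IH (z.1, s)).
Qed.

Variable sigma : R.
Hypothesis s0 : 0 < sigma.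
Let b := sigma `^ (1 / 4).

Lemma scale_factor_gt0 : 0 < b. Proof. exact: powR_gt0. Qed.

Lemma scale_factorE l m : b ^+ l * sigma ^+ m = sigma `^ (l%:R / 4 + m%:R).
Proof.
rewrite powRD; last by rewrite (gt_eqF s0) implybT.
congr (_ * _); last by rewrite powR_mulrn ?(ltW s0).
by rewrite -powR_mulrn ?powR_ge0 // /b -powRrM mul1r mulrC.
Qed.

Variables (G g : ST -> V).
Hypothesis Gg : forall i z, H z.1 -> G z i 0 = g (b *: z.1, sigma * z.2) i 0.

Lemma nabla_vec_scale l m z p : H z.1 ->
  nabla_vec l m G z p = sigma `^ (l%:R / 4 + m%:R) *
    nabla_vec l m g (b *: z.1, sigma * z.2) p.
Proof.
move=> zH; rewrite !ffunE.
rewrite (@partials_ext _ _ _ (dilate 1 b sigma (fun w => g w p.1 0))) //; last first.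
  by move=> z' zH'; rewrite Gg // /dilate mul1r.
rewrite partials_dilate ?oner_eq0 ?scale_factor_gt0 ?gt_eqF //.
by rewrite mul1r size_tuple scale_factorE.
Qed.

Lemma slab_scale a a' (z : ST) : slab a a' z ->
  slab (sigma * a) (sigma * a') (b *: z.1, sigma * z.2).
Proof.
case: z => x t [/= xH]; rewrite in_itv /= => /andP[h1 h2]; split => /=.
  exact: closed_half_spaceZ scale_factor_gt0 xH.
by rewrite in_itv /= !ltr_pM2l // h1.
Qed.

Lemma sup_norm_scale a a' l m : (sup_norm a a' (nabla_vec l m G) <=
  (sigma `^ (l%:R / 4 + m%:R))%:E *
    sup_norm (sigma * a) (sigma * a') (nabla_vec l m g))%E.
Proof.
apply: ereal_sup_le_scale; first exact: powR_gt0.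
move=> e [z sz <-]; exists (fnorm (nabla_vec l m g (b *: z.1, sigma * z.2)))%:E.
  by exists (b *: z.1, sigma * z.2) => //; exact: slab_scale.
rewrite -EFinM; congr (_%:E); apply: fnormZ; first exact: powR_ge0.
by move=> p; apply: nabla_vec_scale; case: sz.
Qed.

Lemma fnorm_diff_scale l m z z' : H z.1 -> H z'.1 ->
  fnorm (nabla_vec l m G z - nabla_vec l m G z') = sigma `^ (l%:R / 4 + m%:R) *
  fnorm (nabla_vec l m g (b *: z.1, sigma * z.2) -
         nabla_vec l m g (b *: z'.1, sigma * z'.2)).
Proof.
move=> zH zH'; apply: fnormZ; first exact: powR_ge0.
by move=> p; rewrite !ffun_subE !nabla_vec_scale // mulrBr.
Qed.

Lemma holder_x_scale mu a a' l m : (holder_x mu a a' (nabla_vec l m G) <=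
  (sigma `^ (l%:R / 4 + m%:R + mu / 4))%:E *
    holder_x mu (sigma * a) (sigma * a') (nabla_vec l m g))%E.
Proof.
apply: ereal_sup_le_scale; first exact: powR_gt0.
move=> e [x [y [t [sx sy xy ->]]]]; have b0 := scale_factor_gt0.
exists (fnorm (nabla_vec l m g (b *: x, sigma * t) - nabla_vec l m g (b *: y, sigma * t))
   / enorm (b *: x - b *: y) `^ mu)%:E.
  exists (b *: x), (b *: y), (sigma * t); split => //.
  - exact: (slab_scale sx).
  - exact: (slab_scale sy).
  - by move=> /(scalerI (lt0r_neq0 b0)).
rewrite -EFinM; congr (_%:E); rewrite fnorm_diff_scale /=; [|by case: sx|by case: sy].
rewrite -scalerBr enormZ ?(ltW b0) // powRM ?(ltW b0) ?sqrtr_ge0 //.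
rewrite (powRD (r := l%:R / 4 + m%:R)); last by rewrite (gt_eqF s0) implybT.
rewrite -(powRrM sigma) (_ : 1 / 4 * mu = mu / 4); last by rewrite mul1r mulrC.
by apply: scale_quotient; rewrite gt_eqF // powR_gt0.
Qed.

Lemma holder_t_scale beta a a' l m : (holder_t beta a a' (nabla_vec l m G) <=
  (sigma `^ (l%:R / 4 + m%:R + beta))%:E *
    holder_t beta (sigma * a) (sigma * a') (nabla_vec l m g))%E.
Proof.
apply: ereal_sup_le_scale; first exact: powR_gt0.
move=> e [x [t [t' [sx sy xy ->]]]].
exists (fnorm (nabla_vec l m g (b *: x, sigma * t) - nabla_vec l m g (b *: x, sigma * t'))
   / `|sigma * t - sigma * t'| `^ beta)%:E.
  exists (b *: x), (sigma * t), (sigma * t'); split => //.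
  - exact: (slab_scale sx).
  - exact: (slab_scale sy).
  - by move=> /(mulfI (lt0r_neq0 s0)).
rewrite -EFinM; congr (_%:E); rewrite fnorm_diff_scale /=; [|by case: sx|by case: sy].
rewrite -mulrBr normrM (gtr0_norm s0) powRM ?(ltW s0) //.
rewrite (powRD (r := l%:R / 4 + m%:R)); last by rewrite (gt_eqF s0) implybT.
by apply: scale_quotient; rewrite gt_eqF // powR_gt0.
Qed.

(** The weight of each term, a power of the length of the time interval, has the parabolic degree of
    that term, so the powers of sigma cancel. All Hölder seminorms share the degree (k + mu) / 4:
    what a derivative of lower order lacks is made up by its time exponent. *)
Lemma BC_norm_scale k mu a a' : a <= a' ->
  (BC_norm k mu a a' G <= BC_norm k mu (sigma * a)%R (sigma * a')%R g)%E.
Proof.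
move=> aa'; have d0 : 0 <= a' - a by rewrite subr_ge0.
rewrite /BC_norm -mulrBr; apply: leeD.
  apply: lee_sum => l _; apply: lee_sum => m _.
  rewrite powRM ?(ltW s0) // (mulrC (sigma `^ _)) EFinM -muleA.
  by rewrite lee_wpmul2l ?lee_fin ?powR_ge0 //; exact: sup_norm_scale.
rewrite powRM ?(ltW s0) // (mulrC (sigma `^ _)) EFinM -muleA.
rewrite lee_wpmul2l ?lee_fin ?powR_ge0 //.
have p0 : 0 < sigma `^ ((k%:R + mu) / 4) by exact: powR_gt0.
rewrite /holder_seminorm gt0_muleDr // !gt0_mule_sumr //.
apply: leeD; apply: lee_sum => l _; rewrite gt0_mule_sumr //; apply: lee_sum => m.
  move=> /eqP lm; rewrite -(_ : (l : nat)%:R / 4 + (m : nat)%:R + mu / 4 = (k%:R + mu) / 4).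
    exact: holder_x_scale.
  by rewrite -[in RHS]lm natrD natrM; field.
move=> _; set be := (X in holder_t X).
rewrite -(_ : (l : nat)%:R / 4 + (m : nat)%:R + be = (k%:R + mu) / 4).
  exact: holder_t_scale.
by rewrite /be; field.
Qed.

End NormScaling.

(** * Rescaled solutions and blow-down *)

Section RescaledSolution.
Variables (R : realType) (n : nat).
Notation V := 'cV[R]_n.+1.
Notation ST := (V * R)%type.
Notation H := (@closed_half_space R n).
Notation Q := (@Q_open R n).

Lemma Q_open_dilate (b tau : R) (z : ST) : 0 < b -> 0 < tau -> Q z -> Q (b *: z.1, tau * z.2).
Proof.
case: z => x t b0 t0 /Q_openP[xH tpos]; apply/Q_openP; split.
  exact: closed_half_spaceZ.
exact: mulr_gt0.
Qed.

Lemma within_continuous_dilate (c b tau : R) (f : ST -> R) : 0 < b -> 0 < tau ->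
  {within Q, continuous f} -> {within Q, continuous (dilate c b tau f)}.
Proof.
move=> b0 t0 /within_continuousP fc; apply/within_continuousP => z Qz e e0.
have c1 : 0 < `|c| + 1 by rewrite ltr_wpDl.
have [d d0 df] := fc _ (Q_open_dilate b0 t0 Qz) _ (divr_gt0 e0 c1).
exists (Num.min (d / b) (d / tau)); first by rewrite lt_min !divr_gt0.
move=> z' Qz'; rewrite !lt_min => /andP[h1 _] /andP[_ h2].
rewrite /dilate -mulrBr normrM.
have := df _ (Q_open_dilate b0 t0 Qz').
rewrite /= -scalerBr -mulrBr normrZ [X in _ -> X < _ -> _]normrM (gtr0_norm b0) (gtr0_norm t0) => h.
have : `|f (b *: z'.1, tau * z'.2) - f (b *: z.1, tau * z.2)| < e / (`|c| + 1).
  by apply: h; rewrite mulrC -ltr_pdivlMr.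
rewrite ltr_pdivlMr // mulrC; apply: le_lt_trans.
by rewrite ler_wpM2r // lerDl.
Qed.

Lemma has_cont_derivs_dilate P (c b tau : R) (f : ST -> R) :
  c != 0 -> 0 < b -> 0 < tau ->
  has_cont_derivs P Q f -> has_cont_derivs P Q (dilate c b tau f).
Proof.
move=> c0 b0 t0 fP l m /fP[fe fc]; have t0' : tau != 0 by rewrite gt_eqF.
split.
  move=> z Qz; apply: partials_exist_dilate => //; first exact: Q_open_half_space.
  by apply: fe; exact: (Q_open_dilate b0 t0 Qz).
apply: (@within_continuous_ext _ _ _
  (dilate (c * b ^+ size l * tau ^+ m) b tau (partials l m f))).
  by move=> z Qz; rewrite partials_dilate //; exact: Q_open_half_space.
exact: within_continuous_dilate.
Qed.

Variable sigma : R.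
Hypothesis s0 : 0 < sigma.
Let b := sigma `^ (1 / 4).
Let c := sigma `^ (- (1 / 4)).
Let b0 : 0 < b := scale_factor_gt0 s0.
Let c0 : 0 < c. Proof. exact: powR_gt0. Qed.
Let cb : c * b = 1.
Proof. by rewrite /c /b powRN mulVf // gt_eqF. Qed.
Let b4 : b ^+ 4 = sigma.
Proof.
have := scale_factorE s0 4 0; rewrite expr0 mulr1 => ->.
by rewrite addr0 divff ?pnatr_eq0 // powRr1 // ltW.
Qed.
Let s0' : sigma != 0. Proof. by rewrite gt_eqF. Qed.
Let c0' : c != 0. Proof. by rewrite gt_eqF. Qed.

Variable u : ST -> R.
Let S (z : ST) : ST := (b *: z.1, sigma * z.2).

Lemma rescaleE : rescale sigma u = dilate c b sigma u. Proof. by []. Qed.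

Lemma partials_rescale l m z : H z.1 -> partials l m (rescale sigma u) z =
  c * b ^+ size l * sigma ^+ m * partials l m u (S z).
Proof. by move=> zH; rewrite rescaleE partials_dilate. Qed.

Lemma grad_rescale z : H z.1 -> grad (rescale sigma u) z = grad u (S z).
Proof.
move=> zH; apply/colP => i; rewrite !mxE.
by have := partials_rescale [:: i] 0 zH; rewrite expr1 expr0 mulr1 cb mul1r.
Qed.

Lemma curvature_rescale z : H z.1 ->
  curvature (rescale sigma u) z = dilate b b sigma (curvature u) z.
Proof.
move=> zH; rewrite /curvature /dilate grad_rescale // -mxtraceZ scalemxAr; congr (\tr (_ *m _)).
apply/matrixP => i j; rewrite !mxE.
have := partials_rescale [:: i; j] 0 zH.
by rewrite expr0 mulr1 expr2 mulrA cb mul1r.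
Qed.

Lemma flux_rescale i z : H z.1 ->
  flux (rescale sigma u) z i 0 = dilate (b * b) b sigma (fun w => flux u w i 0) z.
Proof.
move=> zH; rewrite /flux /dilate grad_rescale //.
rewrite (_ : grad (curvature (rescale sigma u)) z = (b * b) *: grad (curvature u) (S z)).
  by rewrite -scalemxAr !mxE mulrCA.
apply/colP => j; rewrite !mxE.
rewrite (@Dx_ext _ _ j _ (dilate b b sigma (curvature u))) //.
  by rewrite Dx_dilate ?gt_eqF.
by move=> y yH; rewrite curvature_rescale.
Qed.

Lemma div_flux_rescale z : H z.1 -> div (flux (rescale sigma u)) z =
  b * b * b * div (flux u) (S z).
Proof.
move=> zH; rewrite /div mulr_sumr; apply: eq_bigr => i _.
apply: (@etrans _ _ (Dx i (dilate (b * b) b sigma (fun w => flux u w i 0)) z)).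
  by apply: Dx_ext zH => y yH; exact: (@flux_rescale i (y, z.2)).
by apply: Dx_dilate; rewrite ?mulf_neq0 ?(lt0r_neq0 b0).
Qed.

(** Since c * b = 1, the gradient is unchanged up to dilation, hence also the contact angle. The
    time derivative gains c * sigma = c * b^4 = b^3, and so does the divergence of the flux: b from
    the curvature and b from each further derivative. *)
Lemma SD_solution_rescale gamma :
  SD_solution gamma u -> SD_solution gamma (rescale sigma u).
Proof.
move=> [uc ue ua uf].
have bdry (x : V) : x ord_max 0 = 0 -> H x /\ (b *: x) ord_max 0 = 0.
  by move=> xN; rewrite /closed_half_space /= mxE xN mulr0.
split.
- exact: has_cont_derivs_dilate.
- move=> x t xH t0; have xH' : H x by rewrite /closed_half_space /= ltW.
  rewrite div_flux_rescale // rescaleE Dt_dilate // /dilate /=.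
  rewrite (_ : c * sigma = b * b * b).
    rewrite -mulrDr (ue (b *: x)) ?mulr0 ?mulr_gt0 //.
    by rewrite /half_space /= mxE mulr_gt0.
  by rewrite -[X in c * X]b4 !exprS expr0 mulr1 !mulrA cb mul1r.
- move=> x t /bdry[xH xN] t0; have := ua _ _ xN (mulr_gt0 s0 t0).
  have E i : Dx i (rescale sigma u) (x, t) = Dx i u (b *: x, sigma * t).
    by have /colP/(_ i) := @grad_rescale (x, t) xH; rewrite !mxE.
  by under [X in _ -> _ - _ * Num.sqrt (1 + X) = _]eq_bigr => i _ do rewrite E; rewrite E.
- move=> x t /bdry[xH xN] t0; rewrite flux_rescale // /dilate.
  by rewrite uf ?mulr0 // mulr_gt0.
Qed.

End RescaledSolution.

(** * Estimates for rescaled functions with constants independent of the scale *)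

Section Euclidean.
Variables (R : realType) (n : nat).
Notation V := 'cV[R]_n.+1.
Notation ST := (V * R)%type.
Notation H := (@closed_half_space R n).
Notation Q := (@Q_open R n).

Lemma coord_le_fnorm (I : finType) (T : {ffun I -> R}) i : `|T i| <= fnorm T.
Proof.
rewrite /fnorm -sqrtr_sqr ler_sqrt; last by rewrite sumr_ge0 // => j _; exact: sqr_ge0.
by rewrite (bigD1 i) //= lerDl sumr_ge0 // => j _; exact: sqr_ge0.
Qed.

Lemma enorm_le (x : V) : enorm x <= n.+1%:R * `|x|.
Proof.
rewrite -[leRHS]ger0_norm ?mulr_ge0 // -sqrtr_sqr ler_sqrt ?sqr_ge0 //.
have : \sum_(i < n.+1) x i 0 ^+ 2 <= \sum_(i < n.+1) `|x| ^+ 2.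
  apply: ler_sum => i _; rewrite -real_normK ?num_real //.
  by rewrite lerXn2r ?nnegrE // coord_le_norm.
move=> /le_trans; apply; rewrite sumr_const card_ord exprMn -[leLHS]mulr_natl.
rewrite ler_wpM2r ?sqr_ge0 // expr2 -natrM ler_nat; lia.
Qed.

Lemma partials_ext_Q l m (f g : ST -> R) : (forall z, Q z -> f z = g z) ->
  forall z, Q z -> partials l m f z = partials l m g z.
Proof.
move=> fg; elim: l => [|i l IH] z Qz; last exact: (proj2 (Dx_ext_Q i IH Qz)).
elim: m z Qz => [|m IH] z Qz; first exact: fg.
exact: (proj2 (Dt_ext IH Qz)).
Qed.

Lemma uniform_cvgP (K : set ST) (G : R -> ST -> R) (w : ST -> R) :
  (forall e, 0 < e -> \forall s \near +oo, forall z, K z -> `|G s z - w z| <= e) ->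
  {uniform K, G @ +oo --> w}.
Proof.
move=> Gw A; rewrite uniform_nbhs => -[B [eB BA]].
move: eB; rewrite -entourage_ballE => -[e /= e0 eB].
have e2 : 0 < e / 2 by rewrite divr_gt0.
have := Gw _ e2; apply: filterS => s Gs; apply: BA => z Kz; apply: eB => /=.
rewrite /ball /= distrC (le_lt_trans (Gs z Kz)) //.
by rewrite ltr_pdivrMr // mulr_natr mulr2n ltrDl.
Qed.

Variables (sigma : R) (u : ST -> R).
Hypothesis s0 : 0 < sigma.
Let b := sigma `^ (1 / 4).
Let c := sigma `^ (- (1 / 4)).

Lemma partials_rescale_le l m (C : R) :
  (forall x t, H x -> 0 < t -> fnorm (nabla (size l) m u (x, t)) <=
     C * t `^ ((1 - (size l)%:R - 4 * m%:R) / 4)) ->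
  forall x t, H x -> 0 < t -> `|partials l m (rescale sigma u) (x, t)| <=
     C * t `^ ((1 - (size l)%:R - 4 * m%:R) / 4).
Proof.
move=> uC x t xH t0; have -> : partials l m (rescale sigma u) (x, t) =
    c * sigma `^ ((size l)%:R / 4 + m%:R) * partials l m u (b *: x, sigma * t).
  rewrite partials_rescale // -scale_factorE //; congr (_ * _).
  by rewrite mulrA.
have cp : 0 < c by exact: powR_gt0.
have := uC _ _ (closed_half_spaceZ (scale_factor_gt0 s0) xH) (mulr_gt0 s0 t0).
move=> /(le_trans (coord_le_fnorm _ (in_tuple l))); rewrite ffunE /= => h.
rewrite normrM ger0_norm; last by rewrite mulr_ge0 // powR_ge0.
apply: (@le_trans _ _ (c * sigma `^ ((size l)%:R / 4 + m%:R) *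
  (C * (sigma * t) `^ ((1 - (size l)%:R - 4 * m%:R) / 4)))).
  by rewrite ler_wpM2l // mulr_ge0 ?powR_ge0 // ltW.
rewrite powRM ?(ltW s0) ?(ltW t0) //; set p := (_ - _) / 4.
set X := t `^ p.
(* The powers of sigma come from the prefactor, the chain rule and the decay at time sigma * t;
   their exponents add up to 0. *)
have E : c * sigma `^ ((size l)%:R / 4 + m%:R) * sigma `^ p = 1.
  rewrite /c -!powRD; try by rewrite (gt_eqF s0) implybT.
  rewrite (_ : _ + p = 0) ?powRr0 // /p; by field.
rewrite (_ : _ * _ = (c * sigma `^ ((size l)%:R / 4 + m%:R) * sigma `^ p) * (C * X)).
  by rewrite E mul1r.
by ring.
Qed.

Variable u0 : V -> R.

Lemma rescale_initial_le (C : R) :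
  (forall x, H x -> u (x, 0) = u0 x) ->
  (forall x t, H x -> 0 < t -> `|u (x, t) - u0 x| <= C * t `^ (1 / 4)) ->
  forall x t, H x -> 0 <= t ->
    `|rescale sigma u (x, t) - c * u0 (b *: x)| <= C * t `^ (1 / 4).
Proof.
move=> ui uC x t xH; have bH := closed_half_spaceZ (scale_factor_gt0 s0) xH.
have cp : 0 < c by exact: powR_gt0.
rewrite le_eqVlt => /predU1P[<-|t0]; rewrite /rescale /= -/b -/c -mulrBr.
  by rewrite mulr0 ui // subrr mulr0 normr0 powR0 ?mulr0 // gt_eqF.
rewrite normrM (gtr0_norm cp).
apply: (@le_trans _ _ (c * (C * (sigma * t) `^ (1 / 4)))).
  by rewrite ler_wpM2l ?(ltW cp) // uC // mulr_gt0.
rewrite powRM ?(ltW s0) ?(ltW t0) // -/b /c powRN -/b mulrCA [b * _]mulrC [b^-1 * _]mulrC mulfK //.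
by rewrite gt_eqF // scale_factor_gt0.
Qed.

Lemma rescale_lip (L : R) :
  (forall x y, H x -> H y -> `|u0 x - u0 y| <= L * enorm (x - y)) ->
  forall x y, H x -> H y -> `|c * u0 (b *: x) - c * u0 (b *: y)| <= L * enorm (x - y).
Proof.
move=> uL x y xH yH; have b0 := scale_factor_gt0 s0.
have cp : 0 < c by exact: powR_gt0.
rewrite -mulrBr normrM (gtr0_norm cp).
have := uL _ _ (closed_half_spaceZ b0 xH) (closed_half_spaceZ b0 yH).
rewrite -scalerBr enormZ ?(ltW b0) // => /(ler_wpM2l (ltW cp)) /le_trans; apply.
by rewrite mulrCA [c * _]mulrA /c powRN -/b mulVf ?mul1r // gt_eqF.
Qed.

End Euclidean.

(** * Blow-down of the initial datum and of the solution *)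

Section BlowDown.
Variables (R : realType) (n : nat).
Notation V := 'cV[R]_n.+1.
Notation ST := (V * R)%type.
Notation H := (@closed_half_space R n).
Notation Q := (@Q_open R n).
Notation Qc := (@Q_closed R n).
(** Clamping at 1 makes the bounds hold for every real s and not just eventually: the scale is
    positive, and its power -1/4 is at most 1, which controls the blow-downs at the origin. *)
Notation scale s := (Num.max s (1 : R)).

Lemma scale_gt0 (s : R) : 0 < scale s.
Proof. by rewrite lt_max ltr01 orbT. Qed.

Lemma powR4K (a : R) : 0 <= a -> (a `^ 4) `^ (1 / 4) = a.
Proof.
by move=> a0; rewrite -powRrM (_ : 4 * (1 / 4) = 1) ?powRr1 // mulrC divfK.
Qed.

Lemma scale_root_cvgy : (scale s) `^ (1 / 4) @[s --> +oo] --> +oo.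
Proof.
apply/cvgryPge => A; near=> s.
have As : (`|A| + 1) `^ 4 <= s by near: s; exact: nbhs_pinfty_ge.
apply: (@le_trans _ _ (`|A| + 1)); first by rewrite (le_trans (ler_norm A)) // lerDl.
rewrite -[leLHS]powR4K ?addr_ge0 // ge0_ler_powR ?nnegrE ?powR_ge0 // ?(ltW (scale_gt0 s)) //.
by rewrite le_max As.
Unshelve. all: by end_near.
Qed.

Lemma half_space_e_N (x : V) h : H x -> 0 < h -> half_space (x + h *: e_N R n).
Proof.
rewrite /closed_half_space /half_space /= !mxE eqxx mulr1 => x0 h0.
by rewrite ltr_wpDl.
Qed.

Lemma enorm_gt0 (x : V) : half_space x -> 0 < enorm x.
Proof.
rewrite /half_space /= => x0; rewrite sqrtr_gt0 (bigD1 ord_max) //=.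
by rewrite ltr_pwDl ?exprn_gt0 // sumr_ge0 // => j _; exact: sqr_ge0.
Qed.

Variables (u0 psi : V -> R) (L : R).
Hypothesis u0L : forall x y, H x -> H y -> `|u0 x - u0 y| <= L * enorm (x - y).
Hypothesis u0_lim : forall eta, half_sphere eta ->
  (u0 (r *: eta) / r) @[r --> +oo] --> psi eta.

Let g (s : R) (x : V) : R :=
  (scale s) `^ (- (1 / 4)) * u0 ((scale s) `^ (1 / 4) *: x).

(** The point magnified by sigma^(1/4) lies on the ray through x at radius r = sigma^(1/4) * |x|, so
    g s x is |x| times the quotient in [u0_lim] at radius r. *)
Lemma blowdown_interior x : half_space x -> g s x @[s --> +oo] --> hom_ext psi x.
Proof.
move=> x0; have e0 := enorm_gt0 x0.
have eta : half_sphere ((enorm x)^-1 *: x).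
  split; last by rewrite /half_space /= mxE mulr_gt0 // invr_gt0.
  by rewrite enormZ ?invr_ge0 ?(ltW e0) // mulVf // gt_eqF.
have ry : (scale s) `^ (1 / 4) * enorm x @[s --> +oo] --> +oo.
  by apply: gt0_cvgMly => //; exact: scale_root_cvgy.
pose q (r : R) := u0 (r *: ((enorm x)^-1 *: x)) / r.
rewrite (_ : (fun s => g s x) =
  fun s => enorm x * (q ((scale s) `^ (1 / 4) * enorm x))).
  by apply: cvgM; [exact: cvg_cst|exact: (cvg_comp _ _ ry (u0_lim eta))].
apply/funext => s; rewrite /q /g scalerA mulfK ?gt_eqF // powRN; set p := _ `^ _.
have p0 : 0 < p by rewrite powR_gt0 // scale_gt0.
by field; rewrite !gt_eqF.
Qed.

Hypothesis psi_cont : forall x, H x -> forall e, 0 < e -> exists2 d, 0 < d &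
  forall y, H y -> `|y - x| < d -> `|hom_ext psi y - hom_ext psi x| < e.

Lemma blowdown_lip s x y : H x -> H y -> `|g s x - g s y| <= L * enorm (x - y).
Proof. exact: (rescale_lip (scale_gt0 s) u0L). Qed.

(* u0_lim only concerns the open half-space; a boundary point x is approximated by
   x + h e_N, using that the blow-downs are equi-Lipschitz. *)
Lemma blowdown_cvg x : H x -> g s x @[s --> +oo] --> hom_ext psi x.
Proof.
move=> xH; apply/cvgrPdist_le => e e0.
have e3 : 0 < e / 3 by rewrite divr_gt0.
have [d d0 dpsi] := psi_cont xH e3.
have M0 : 0 < `|L| * n.+1%:R + 1 by rewrite ltr_wpDl // mulr_ge0.
pose h := Num.min (d / 2) (e / 3 / (`|L| * n.+1%:R + 1)).
have h0 : 0 < h by rewrite lt_min !divr_gt0.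
pose y := x + h *: e_N R n.
have y0 : half_space y by exact: half_space_e_N.
have yH : H y by exact: ltW.
have yx : `|y - x| <= h.
  rewrite /y addrC addKr normrZ gtr0_norm // ler_piMr ?(ltW h0) //.
  exact: norm_basis_vec.
have hd : h < d.
  by rewrite gt_min (_ : d / 2 < d) // ltr_pdivrMr // mulr_natr mulr2n ltrDl.
have psiyx := dpsi y yH (le_lt_trans yx hd).
have gyx s : `|g s y - g s x| <= e / 3.
  apply: (le_trans (blowdown_lip s yH xH)).
  apply: (@le_trans _ _ (`|L| * (n.+1%:R * h))).
    apply: (@le_trans _ _ (`|L| * enorm (y - x))).
      by rewrite ler_wpM2r ?sqrtr_ge0 // ler_norm.
    rewrite ler_wpM2l // (le_trans (enorm_le _)) // ler_wpM2l //.
  rewrite mulrA (@le_trans _ _ ((`|L| * n.+1%:R + 1) * h)) //.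
    by rewrite ler_wpM2r ?(ltW h0) // lerDl.
  by rewrite mulrC -ler_pdivlMr // ge_min lexx orbT.
move/cvgrPdist_le: (blowdown_interior y0) => /(_ _ e3); apply: filterS => s gs.
rewrite (_ : _ - _ = - (hom_ext psi y - hom_ext psi x) +
   ((hom_ext psi y - g s y) + (g s y - g s x))); last by ring.
apply: (le_trans (ler_normD _ _)); rewrite normrN.
have := ler_normD (hom_ext psi y - g s y) (g s y - g s x).
have := gyx s; move: gs psiyx; lra.
Qed.

(** All blow-downs of u0 have the Lipschitz constant L, and so does their pointwise limit. *)
Lemma hom_ext_lip : Lip H (hom_ext psi).
Proof.
exists L => x y xH yH; rewrite -[X in `|X|]subr0.
apply: (@cvg_dist_le R _ +oo (fun s => g s x - g s y)).
  by apply: cvgB; exact: blowdown_cvg.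
by apply: filterE => s; rewrite subr0; exact: blowdown_lip.
Qed.

Variable u : ST -> R.
Hypothesis u_smooth : smooth u.
Hypothesis u_init : forall x, H x -> u (x, 0) = u0 x.
Hypothesis u_decay : forall l m, (0 < l + m)%N -> exists C : R, forall x t, H x -> 0 < t ->
  fnorm (nabla l m u (x, t)) <= C * t `^ ((1 - l%:R - 4 * m%:R) / 4).
Variable C : R.
Hypothesis u_near : forall x t, H x -> 0 < t -> `|u (x, t) - u0 x| <= C * t `^ (1 / 4).

Let F (s : R) : ST -> R := rescale (scale s) u.

Lemma blowdown_smooth_family : smooth_family F.
Proof.
split.
  move=> s; apply: has_cont_derivs_dilate u_smooth; rewrite ?powR_gt0 ?scale_gt0 //.
  by rewrite gt_eqF // powR_gt0 // scale_gt0.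
move=> l m lm a b a0; have [D uD] := u_decay lm.
set p := (1 - (size l)%:R - 4 * m%:R) / 4 in uD.
(* For a genuine derivative l + 4m is at least 1, so the power of t does not increase and its value
   at t = a bounds it on the whole interval. *)
have p0 : p <= 0.
  have : (1 : R) <= (size l + 4 * m)%:R by rewrite ler1n; lia.
  by rewrite natrD natrM /p; lra.
exists (`|D| * a `^ p) => s x t xH /andP[at_ _]; have t0 := lt_le_trans a0 at_.
apply: (le_trans (partials_rescale_le (scale_gt0 s) uD xH t0)).
apply: (@le_trans _ _ (`|D| * t `^ p)); first by rewrite ler_wpM2r ?powR_ge0 // ler_norm.
rewrite ler_wpM2l //; have [q q0 ->] : exists2 q, 0 <= q & p = - q.
  by exists (- p); rewrite ?oppr_ge0 ?opprK.
rewrite !powRN lef_pV2 ?posrE ?powR_gt0 //.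
by rewrite ge0_ler_powR ?nnegrE // ltW.
Qed.

Lemma blowdown_initial_le s x t : H x -> 0 <= t -> `|F s (x, t) - g s x| <= C * t `^ (1 / 4).
Proof. exact: (rescale_initial_le (scale_gt0 s) u_init u_near). Qed.

Lemma Q_closedP (x : V) t : Qc (x, t) <-> H x /\ 0 <= t.
Proof. by split; rewrite /Q_closed /=; move=> [a b]; split=> //; move: b => /=; rewrite in_itv /= andbT. Qed.

(** For t > 0 the derivative bounds do it. At t = 0 they degenerate; there F s is compared with its
    initial datum, at a cost of order t^(1/4), and the initial data are equi-Lipschitz. *)
Lemma blowdown_equicontinuous : equicontinuous_on Qc F.
Proof.
move=> [x t] /Q_closedP[xH]; rewrite le_eqVlt => /predU1P[<-|t0] e e0; last first.
  have Qz : Q (x, t) by apply/Q_openP.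
  have [d d0 dF] := smooth_family_equicontinuous [::] 0 blowdown_smooth_family Qz e0.
  exists (Num.min d t); first by rewrite lt_min d0.
  move=> s [y t'] /Q_closedP[yH _] /=; rewrite !lt_min => /andP[h1 _] /andP[h2 h3].
  apply: (dF s (y, t')) => //; apply/Q_openP; split => //.
  by move: h3; rewrite ltr_norml => /andP[]; lra.
have M0 : 0 < `|L| * n.+1%:R + 1 by rewrite ltr_wpDl // mulr_ge0.
have C0 : 0 < `|C| + 1 by rewrite ltr_wpDl.
have e2 : 0 < e / 2 by rewrite divr_gt0.
(* The fourth power undoes the exponent 1/4 of the time estimate; the factor [n.+1] compares the
   Euclidean norm with the sup norm. *)
exists (Num.min (e / 2 / (`|L| * n.+1%:R + 1)) ((e / 2 / (`|C| + 1)) `^ 4)).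
  by rewrite lt_min divr_gt0 // powR_gt0 // divr_gt0.
move=> s [y t'] /Q_closedP[yH t'0] /=; rewrite !lt_min => /andP[h1 _] /andP[_].
rewrite subr0 ger0_norm // => h2.
have F0 : F s (x, 0) = g s x.
  by apply/eqP; rewrite -subr_eq0 -normr_le0 (le_trans (blowdown_initial_le s xH (lexx 0))) // powR0 ?mulr0 // gt_eqF.
rewrite F0 (_ : _ - _ = (F s (y, t') - g s y) + (g s y - g s x)); last by ring.
rewrite (le_trans (ler_normD _ _)) // [leRHS](_ : e = e / 2 + e / 2); last by field.
apply: lerD.
  apply: (le_trans (blowdown_initial_le s yH t'0)).
  apply: (@le_trans _ _ ((`|C| + 1) * (e / 2 / (`|C| + 1)))); last first.
    by rewrite mulrC divfK // gt_eqF.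
  apply: (@le_trans _ _ ((`|C| + 1) * t' `^ (1 / 4))).
    by rewrite ler_wpM2r ?powR_ge0 // (le_trans (ler_norm C)) // lerDl.
  rewrite ler_wpM2l ?(ltW C0) //.
  by rewrite -[leRHS]powR4K ?(ltW (divr_gt0 _ _)) // ge0_ler_powR ?nnegrE ?powR_ge0 // ltW.
apply: (le_trans (blowdown_lip s yH xH)).
apply: (@le_trans _ _ (`|L| * (n.+1%:R * `|y - x|))).
  apply: (@le_trans _ _ (`|L| * enorm (y - x))).
    by rewrite ler_wpM2r ?sqrtr_ge0 // ler_norm.
  by rewrite ler_wpM2l // enorm_le.
rewrite mulrA (@le_trans _ _ ((`|L| * n.+1%:R + 1) * `|y - x|)) //.
  by rewrite ler_wpM2r // lerDl.
by rewrite mulrC -ler_pdivlMr // ltW.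
Qed.

Lemma blowdown_bounded z : Qc z -> exists M, forall s, `|F s z| <= M.
Proof.
case: z => x t /Q_closedP[xH t0].
have H0 : H (0 : V) by rewrite /closed_half_space /= mxE.
exists (C * t `^ (1 / 4) + (L * enorm (x - 0) + `|u0 0|)) => s.
rewrite (_ : F s (x, t) = (F s (x, t) - g s x) + ((g s x - g s 0) + g s 0)); last by ring.
rewrite (le_trans (ler_normD _ _)) // lerD ?blowdown_initial_le //.
rewrite (le_trans (ler_normD _ _)) // lerD ?blowdown_lip //.
rewrite /g scaler0 normrM ler_piMl // ger0_norm ?powR_ge0 // powRN invf_le1 ?powR_gt0 ?scale_gt0 //.
by rewrite -[leLHS](powRr0 (scale s)) ler_powR // le_max lexx orbT.
Qed.

End BlowDown.

(** * The Z-norm of the limit *)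

Section ZNormLimit.
Variables (R : realType) (n : nat).
Notation V := 'cV[R]_n.+1.
Notation ST := (V * R)%type.
Notation H := (@closed_half_space R n).
Notation Q := (@Q_open R n).
Variables (U : set_system R) (sc : R -> R) (u w : ST -> R).
Hypotheses (UP : ProperFilter U) (sc0 : forall s, 0 < sc s).
Hypotheses (Fs : forall s, smooth (rescale (sc s) u)) (ws : smooth w).
Hypothesis Fw : forall l m z, Q z ->
  partials l m (rescale (sc s) u) z @[s --> U] --> partials l m w z.

Lemma grad_subE (f : ST -> R) (c : V) i :
  (fun z => (grad f z - c) i 0) = fun z => Dx i f z - c i 0.
Proof. by apply/funext => z; rewrite !mxE. Qed.

(** Scaling maps the interval from t / 2 to t onto one of the same shape with T = sc s * t in place
    of t, so each BC norm of a rescaled gradient is bounded by the Z-norm for u. Lower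
    semicontinuity hands this bound on to w. *)
Lemma Z_norm_limit k mu (c : V) :
  (Z_norm k mu (fun z => (grad w z - c)%R) <= Z_norm k mu (fun z => (grad u z - c)%R))%E.
Proof.
apply: ge_ereal_sup => e [t /=]; rewrite in_itv /= andbT => t0 <-.
have t2 : 0 <= t / 2 by rewrite ltW // divr_gt0.
apply: (@lsc_le R U UP (fun s => BC_norm k mu (t / 2) t
  (fun z => (grad (rescale (sc s) u) z - c)%R))) => [|s].
  apply: BC_norm_lsc => // l m i z Qz; rewrite grad_subE partials_subc.
  rewrite (_ : (fun s => _) = fun s => partials (rcons l i) m (rescale (sc s) u) z -
    (if (size l + m)%N is 0%N then c i 0 else 0)).
    by rewrite partials_Dx //; apply: cvgB; [exact: Fw|exact: cvg_cst].
  by apply/funext => s; rewrite grad_subE partials_subc partials_Dx.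
apply: (@le_trans _ _ (BC_norm k mu (sc s * (t / 2)) (sc s * t) (fun z => grad u z - c))).
  apply: BC_norm_scale => //; last by lra.
  move=> i z zH; rewrite [LHS]mxE [RHS]mxE; congr (_ + _).
  by rewrite grad_rescale.
apply: ereal_sup_ubound; exists (sc s * t); last by rewrite mulrA.
by rewrite /= in_itv /= andbT mulr_gt0.
Qed.

Lemma in_hatB_limit mu gamma0 delta :
  in_hatB mu gamma0 delta u -> in_hatB mu gamma0 delta w.
Proof.
move=> [[_ _ [_ uZ]] uB]; split; last exact: le_trans (Z_norm_limit _ _ _) uB.
have grad0E (f : ST -> R) : grad f = fun z => grad f z - 0.
  by apply/funext => z; rewrite subr0.
split; [by have [_] := @ws [::] 0%N isT| |split].
- by move=> i x t Qz; have [/(_ _ Qz)] := @ws [:: i] 0%N isT.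
- move=> i l m _; rewrite (_ : (fun z => grad w z i 0) = Dx i w).
    exact: smooth_Dx.
  by apply/funext => z; rewrite mxE.
- rewrite grad0E; apply: le_lt_trans (Z_norm_limit _ _ _) _.
  by rewrite -grad0E.
Qed.

End ZNormLimit.

Theorem corollary2p4 (R : realType) (n : nat) (mu gamma0 eps delta : R)
  (mu01 : 0 < mu < 1) (eps_gt0 : 0 < eps) (delta_gt0 : 0 < delta)
  (W : well_posed n mu gamma0 eps delta)
  (gamma : R) (u0 psi : 'cV[R]_n.+1 -> R)
  (gamma_close : `|gamma - gamma0| < eps)
  (u0_lip : Lip (@closed_half_space R n) u0)
  (u0_close : grad_close gamma0 eps u0)
  (psi_lip : Lip (@closed_half_sphere R n) psi)
  (psi_close : grad_close gamma0 eps (hom_ext psi))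
  (u0_lim : forall eta, half_sphere eta ->
     (u0 (r *: eta) / r) @[r --> +oo] --> psi eta)
  (u : 'cV[R]_n.+1 * R -> R)
  (u_sol : solution_in_hatB mu gamma0 delta gamma u0 u)
  (v : 'cV[R]_n.+1 * R -> R)
  (v_sol : solution_in_hatB mu gamma0 delta gamma (hom_ext psi) v)
  (v_selfsim : self_similar v) :
  (forall K : set ('cV[R]_n.+1 * R), compact K -> K `<=` @Q_closed R n ->
     {uniform K, (fun sigma => rescale sigma u) @ +oo --> v}) /\
  (forall (l m : nat) (s : l.-tuple 'I_n.+1) (K : set ('cV[R]_n.+1 * R)),
     compact K -> K `<=` @Q_open R n ->
     {uniform K, (fun sigma => partials s m (rescale sigma u)) @ +oo
        --> partials s m v}).
Proof.
have [Wex Wsm Wdec] := W gamma gamma_close.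
have adm0 : admissible_data gamma0 eps u0 by split.
have u_smooth : smooth u by exact: Wsm adm0 u_sol.
have [L u0L] := u0_lip.
have [uB uSD [_ u_init]] := u_sol.
have [vB vSD [v_cont v_init]] := v_sol.
have u_decay l m : (0 < l + m)%N -> exists C : R, forall x t,
    closed_half_space x -> 0 < t ->
    fnorm (nabla l m u (x, t)) <= C * t `^ ((1 - l%:R - 4 * m%:R) / 4).
  move=> lm; have [|C uC] := Wdec l m.
    by apply/eqP => -[l0 m0]; move: lm; rewrite l0 m0.
  by exists C => x t xH t0; exact: (uC u0 u adm0 u_sol x t xH t0).1.
(* The estimate of u - u0 is bundled with each derivative estimate; the pair (1, 0) is one choice
   from which to extract it. *)
have [//|C uC] := Wdec 1%N 0%N.
have u_near x t : closed_half_space x -> 0 < t -> `|u (x, t) - u0 x| <= C * t `^ (1 / 4).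
  by move=> xH t0; exact: (uC u0 u adm0 u_sol x t xH t0).2.
(* Continuity of the 1-homogeneous extension, boundary and origin included, is read off v, which
   equals it at t = 0 and is continuous up to that time. *)
have psi_cont x : closed_half_space x -> forall e, 0 < e -> exists2 d, 0 < d &
    forall y, closed_half_space y -> `|y - x| < d -> `|hom_ext psi y - hom_ext psi x| < e.
  move=> xH e e0; have Qx : Q_closed (x, 0) by apply/Q_closedP.
  have [d d0 dv] := (within_continuousP _ _).1 v_cont _ Qx e e0.
  exists d => // y yH yx; rewrite -!v_init //; apply: dv => //=.
    by apply/Q_closedP.
  by rewrite subrr normr0.
have adm_psi : admissible_data gamma0 eps (hom_ext psi).
  by split=> //; exact: (hom_ext_lip u0L u0_lim psi_cont).
pose sc (s : R) := Num.max s 1.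
pose F s := rescale (sc s) u.
have FF : smooth_family F := blowdown_smooth_family u_smooth u_decay.
have Feq : equicontinuous_on (@Q_closed R n) F :=
  blowdown_equicontinuous u0L u_smooth u_init u_decay u_near.
have Q_sub z : Q_open z -> Q_closed z.
  by case: z => x t /Q_openP[xH t0]; apply/Q_closedP; split=> //; exact: ltW.
have key (U : set_system R) : UltraFilter U -> +oo `<=` U ->
    (forall z, Q_closed z -> F s z @[s --> U] --> v z) /\
    (forall l m z, Q_open z -> partials l m (F s) z @[s --> U] --> partials l m v z).
  move=> UU sU; have UP : ProperFilter U by exact: ultra_proper.
  pose w z := lim (F s z @[s --> U]).
  have Fw z : Q_closed z -> F s z @[s --> U] --> w z.
    move=> Qz; have [M FM] := blowdown_bounded u0L u_init u_near Qz.
    by have [y Fy] := ultra_bounded_cvg UU FM; rewrite /w (cvg_lim _ Fy).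
  pose D l m z := lim (partials l m (F s) z @[s --> U]).
  have FD l m z : Q_open z -> partials l m (F s) z @[s --> U] --> D l m z.
    (* Order 0 is treated apart: the family bounds start at order one, and the limit of the
       functions themselves comes from [blowdown_bounded]. *)
    case: z => x t Qz; have [lm|] := ltnP 0 (size l + m); last first.
      rewrite leqn0 addn_eq0 => /andP[/nilP -> /eqP ->].
      change (F s (x, t) @[s --> U] --> w (x, t)); apply: Fw; exact: Q_sub.
    have [xH t0] := (Q_openP _ _).1 Qz.
    have [M FM] := FF.2 l m lm t t t0.
    have FM' s : `|partials l m (F s) (x, t)| <= M by apply: FM; rewrite ?lexx.
    by have [y Fy] := ultra_bounded_cvg UU FM'; rewrite /D (cvg_lim _ Fy).
  have wD z : Q_open z -> w z = D [::] 0%N z by [].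
  have ws : smooth w := limit_smooth UP FF FD wD.
  have FDw l m z : Q_open z -> partials l m (F s) z @[s --> U] --> partials l m w z.
    by move=> Qz; rewrite (limit_partials UP FF FD wD) //; exact: FD.
  have sc0 s : 0 < sc s by exact: scale_gt0.
  have w_sol : solution_in_hatB mu gamma0 delta gamma (hom_ext psi) w.
    split.
    - exact: (in_hatB_limit UP sc0 FF.1 ws FDw uB).
    - apply: (SD_solution_limit UP FF.1 ws FDw) => s.
      exact: SD_solution_rescale.
    split; first exact: (equicontinuous_limit UP Feq Fw).
    move=> x xH; have Qx : Q_closed (x, 0) by apply/Q_closedP.
    apply: (cvg_unique _ (Fw _ Qx)) => //=.
    have gx := blowdown_cvg u0L u0_lim psi_cont xH.
    rewrite (_ : (fun s => F s (x, 0)) = fun s =>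
      (Num.max s 1) `^ (- (1 / 4)) * u0 ((Num.max s 1) `^ (1 / 4) *: x)).
      by move=> A /gx; exact: sU.
    apply/funext => s; rewrite /F /rescale /= mulr0 u_init //.
    by apply: closed_half_spaceZ => //; rewrite powR_gt0.
  (* Well-posedness compares every solution with one solution u', so w and v are identified through
     it. *)
  have [u' [_ u'_uniq]] := Wex _ adm_psi.
  have wv z : Q_closed z -> w z = v z.
    by move=> Qz; rewrite (u'_uniq w) // (u'_uniq v).
  split=> [z Qz|l m z Qz]; first by rewrite -wv //; exact: Fw.
  rewrite -(@partials_ext_Q _ _ l m w v) //; first exact: FDw.
  by move=> z' Qz'; apply: wv; exact: Q_sub.
(* For s at least 1 the clamping has no effect, so the limit as s tends to infinity does not see
   it. *)
have F_rescale : \forall s \near +oo, F s = rescale s u.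
  near=> s; rewrite /F /sc max_l //; near: s; exact: nbhs_pinfty_ge.
split=> [K Kc KQ|l m s K Kc KQ]; apply: uniform_cvgP => e e0.
  have Fv z : Q_closed z -> F s z @[s --> +oo] --> v z.
    by move=> Qz; apply: ultra_cvg => U UU sU; exact: (key U UU sU).1.
  have := equicontinuous_uniform _ Feq Fv Kc KQ e0.
  by move=> /(_ _); apply: filterS2 F_rescale => s <-.
have Fv z : Q_open z -> partials s m (F r) z @[r --> +oo] --> partials s m v z.
  by move=> Qz; apply: ultra_cvg => U UU sU; exact: (key U UU sU).2.
have := equicontinuous_uniform _ (smooth_family_equicontinuous s m FF) Fv Kc KQ e0.
by move=> /(_ _); apply: filterS2 F_rescale => r <-.
Unshelve. all: by end_near.
Qed.
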